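(* Let $M\subseteq\mathbb{Z}^q_{\geq0}$ be a seminormal affine monoid, let $\mathcal{A}(M)=\{m\in\mathbb{Z}_{>0}\mid \frac1mM\cap\mathbb{Z}M=M\}$, and let $s=\operatorname{mpdim}(M)$. Then the limit $$\operatorname{mpr}(M):=\lim_{t\to\infty}\frac{|V_{m_t}(M)|}{m_t^s}$$ exists and is positive for every increasing sequence $m_1<m_2<\cdots$ of elements $m_t\in\mathcal{A}(M)$ (its value, denoted $\operatorname{mpr}(M)$, being the same for all such sequences). Furthermore, if $M$ is normal, then $\operatorname{mpr}(M)\in\mathbb{Q}_{>0}$.
   Context: An affine monoid $M\subseteq\mathbb{Z}^q_{\geq 0}$ ($q$ a positive integer) is a finitely generated submonoid of $\mathbb{Z}^q$ contained in $\mathbb{Z}^q_{\geq0}$. $\mathbb{Z}M$ is the group generated by $M$, $C(M)=\mathbb{R}_{\geq0}M$ is the cone generated by $M$, and the rank of a monoid $N$ is $\dim_{\mathbb{Q}}(\mathbb{Q}\otimes_{\mathbb{Z}}\mathbb{Z}N)$. $M$ is seminormal if whenever $\alpha\in\mathbb{Z}M$ satisfies $2\alpha\in M$ and $3\alpha\in M$, then $\alpha\in M$; $M$ is normal if $C(M)\cap\mathbb{Z}M=M$. A subset $U\subseteq\mathbb{Q}^q$ is an $M$-module if $U+M\subseteq U$. An inclusion $U\subseteq V$ of $M$-modules in $\mathbb{Q}^q$ is pure if $V\setminus U$ is also an $M$-module. With $\frac1mM=\{\gamma/m:\gamma\in M\}$, set $$V_m(M)=\left\{\alpha\in\tfrac1mM\;\middle|\;(\alpha+M)\subseteq\tfrac1mM\text{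 is pure}\right\},$$ equivalently the set of $\alpha\in\frac1mM$ with $(\frac1mM-\alpha)\cap\mathbb{Z}M\subseteq M$. The pure prime of $M$ is $\mathcal{P}(M)=M\setminus\bigcup_{m\in\mathbb{Z}_{>1}}mV_m(M)$. There is a face $\mathcal{F}_M$ of $C(M)$ (the pure prime face) with $M\setminus\mathcal{P}(M)=M\cap\mathcal{F}_M$; the pure dimension is $\operatorname{mpdim}(M)=\operatorname{rank}(M\cap\mathcal{F}_M)$ (set to $-\infty$ if $\mathcal{F}_M=\emptyset$). *)

(* Defs.v *)
From HB Require Import structures.
From mathcomp Require Import all_boot all_order all_algebra.
From mathcomp Require Import all_classical all_reals all_analysis.
Set Implicit Arguments. Unset Strict Implicit. Unset Printing Implicit Defensive.
Import Order.TTheory GRing.Theory Num.Theory numFieldNormedType.Exports.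
Local Open Scope classical_set_scope.
Local Open Scope ring_scope.

Definition toQ (q : nat) (x : 'rV[int]_q) : 'rV[rat]_q := map_mx intr x.
Definition toR (R : realType) (q : nat) (x : 'rV[int]_q) : 'rV[R]_q :=
  map_mx intr x.

Definition affine_monoid (q : nat) (M : set 'rV[int]_q) : Prop :=
  (exists (n : nat) (g : 'I_n -> 'rV[int]_q),
     M = [set x | exists c : 'I_n -> nat, x = \sum_i g i *+ c i]) /\
  (forall x, M x -> forall j, 0 <= x 0 j).

Definition gen_group (q : nat) (N : set 'rV[int]_q) : set 'rV[int]_q :=
  smallest [set G : set 'rV[int]_q |
    G 0 /\ (forall x y, G x -> G y -> G (x - y))] N.

Definition gen_cone (R : realType) (q : nat) (N : set 'rV[int]_q) :
    set 'rV[R]_q :=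
  [set x | exists (n : nat) (c : 'I_n -> R) (v : 'I_n -> 'rV[int]_q),
     [/\ forall i, 0 <= c i, forall i, N (v i)
       & x = \sum_i c i *: toR R (v i)]].
Arguments gen_cone R {q} N.

Definition is_Qspan (q : nat) (S : set 'rV[rat]_q) (U : {vspace 'rV[rat]_q}) :
    Prop :=
  (forall x, S x -> x \in U) /\
  (forall W : {vspace 'rV[rat]_q}, (forall x, S x -> x \in W) -> (U <= W)%VS).

Definition Qspan (q : nat) (S : set 'rV[rat]_q) : {vspace 'rV[rat]_q} :=
  xget 0%VS [set U | is_Qspan S U].

(* As QQ is flat over ZZ, the inclusion of ZN in QQ^q identifies QQ (x) ZN with
   the QQ-subspace of QQ^q spanned by ZN. *)
Definition rank (q : nat) (N : set 'rV[int]_q) : nat :=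
  \dim (Qspan (@toQ q @` gen_group N)).

Definition seminormal (q : nat) (M : set 'rV[int]_q) : Prop :=
  forall a, gen_group M a -> M (a *+ 2) -> M (a *+ 3) -> M a.

Definition normal_monoid (R : realType) (q : nat) (M : set 'rV[int]_q) : Prop :=
  gen_cone R M `&` (@toR R q @` gen_group M) = @toR R q @` M.

Definition is_module (q : nat) (M : set 'rV[int]_q) (U : set 'rV[rat]_q) : Prop :=
  forall u x, U u -> M x -> U (u + toQ x).

Definition pure (q : nat) (M : set 'rV[int]_q) (U V : set 'rV[rat]_q) : Prop :=
  [/\ is_module M U, is_module M V, U `<=` V & is_module M (V `\` U)].

Definition frac (q : nat) (M : set 'rV[int]_q) (m : nat) : set 'rV[rat]_q :=
  [set m%:R^-1 *: toQ x | x in M].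

Definition translate (q : nat) (M : set 'rV[int]_q) (a : 'rV[rat]_q) :
    set 'rV[rat]_q :=
  [set a + toQ x | x in M].

Definition Vset (q : nat) (M : set 'rV[int]_q) (m : nat) : set 'rV[rat]_q :=
  [set a | frac M m a /\ pure M (translate M a) (frac M m)].

Definition pure_prime (q : nat) (M : set 'rV[int]_q) : set 'rV[int]_q :=
  M `\` [set x | exists m : nat,
    (1 < m)%N /\ exists2 a, Vset M m a & toQ x = m%:R *: a].

(* Faces are cut out by valid affine inequalities, so both C and set0 are faces
   of C. *)
Definition is_face (R : realType) (q : nat) (C F : set 'rV[R]_q) : Prop :=
  exists (l : 'cV[R]_q) (b : R),
    (forall x, C x -> b <= (x *m l) 0 0) /\
    F = C `&` [set x | (x *m l) 0 0 = b].

Definition is_pure_prime_face (R : realType) (q : nat) (M : set 'rV[int]_q)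
    (F : set 'rV[R]_q) : Prop :=
  is_face (gen_cone R M) F /\ M `\` pure_prime M = M `&` (@toR R q @^-1` F).

Definition pure_prime_face (R : realType) (q : nat) (M : set 'rV[int]_q) :
    set 'rV[R]_q :=
  xget set0 [set F | is_pure_prime_face M F].
Arguments pure_prime_face R {q} M.

(* None stands for -oo. *)
Definition mpdim (R : realType) (q : nat) (M : set 'rV[int]_q) : option nat :=
  if `[< pure_prime_face R M = set0 >] then None
  else Some (rank (M `&` (@toR R q @^-1` pure_prime_face R M))).

Definition Aset (q : nat) (M : set 'rV[int]_q) : set nat :=
  [set m | (0 < m)%N /\ frac M m `&` (@toQ q @` gen_group M) = @toQ q @` M].

(* The next two lemmas guard against default values: Qspan does select the
   spanned subspace, and the cardinality of Vset M m is never that of an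
   infinite set. *)
Lemma QspanP (q : nat) (S : set 'rV[rat]_q) : is_Qspan S (Qspan S).
Proof.
apply: xgetPex.
pose P d := exists U : {vspace 'rV[rat]_q},
  (forall x, S x -> x \in U) /\ \dim U = d.
have exP : exists d, `[< P d >].
  exists (\dim (fullv : {vspace 'rV[rat]_q})); apply/asboolP.
  by exists fullv; split=> // x _; rewrite memvf.
case: (ex_minnP exP) => d /asboolP[U [SU dU]] dmin.
exists U; split=> // W SW.
suff <- : (U :&: W)%VS = U by exact: capvSr.
apply/eqP; rewrite eqEdim capvSl /= dU; apply: dmin; apply/asboolP.
exists (U :&: W)%VS; split=> // x Sx.
by rewrite memv_cap SU ?SW.
Qed.

Lemma finite_Vset (q : nat) (M : set 'rV[int]_q) (m : nat) :
  affine_monoid M -> (0 < m)%N -> finite_set (Vset M m).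
Proof.
move=> [[n [g Mg]] M0] m0.
have gM (c : 'I_n -> nat) : M (\sum_i g i *+ c i) by rewrite Mg; exists c.
have toQD x y : @toQ q (x + y) = toQ x + toQ y by rewrite /toQ map_mxD.
have toQn x k : @toQ q (x *+ k) = k%:R *: toQ x.
  elim: k => [|k IH]; first by rewrite mulr0n scale0r /toQ map_mx0.
  by rewrite mulrS toQD IH -natr1 scalerDl scale1r addrC.
have m0Q : (m%:R : rat) != 0 by rewrite pnatr_eq0 -lt0n.
have MZ : M 0.
  by rewrite -(_ : \sum_i g i *+ (fun=> 0%N) i = 0) //; apply: big1.
apply: (@sub_finite_set _ _
  [set m%:R^-1 *: toQ (\sum_i g i *+ (c i : nat)) |
     c in [set: {ffun 'I_n -> 'I_m}]]); last exact: finite_image.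
move=> a [[x Mx <-] [_ _ _ pur]].
move: Mx (Mx); rewrite {1}Mg => -[c xc] Mx.
have key i : (m <= c i)%N -> g i = 0.
  move=> mc.
  pose c' j := if j == i then (c j - m)%N else c j.
  pose y := \sum_j g j *+ c' j.
  have xy : x = y + g i *+ m.
    rewrite xc /y (bigD1 i) //= [in RHS](bigD1 i) //= {1}/c' eqxx.
    rewrite addrAC -mulrnDr subnK //; congr (_ + _).
    by apply: eq_bigr => j /negbTE ji; rewrite /c' ji.
  have Mgi : M (g i).
    rewrite (_ : g i = \sum_j g j *+ (j == i)); first exact: gM.
    rewrite (bigD1 i) //= eqxx mulr1n big1 ?addr0 // => j /negbTE ->.
    by rewrite mulr0n.
  have axy : m%:R^-1 *: toQ x = m%:R^-1 *: toQ y + toQ (g i).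
    by rewrite xy toQD toQn scalerDr scalerA mulVf // scale1r.
  apply: contrapT => gi0.
  have : (frac M m `\` translate M (m%:R^-1 *: toQ x)) (m%:R^-1 *: toQ y).
    split; first by exists y => //; exact: gM.
    move=> [z Mz]; rewrite axy -addrA -toQD => /eqP.
    rewrite addrC -subr_eq0 addrK => /eqP gz.
    apply: gi0; apply/rowP => j; rewrite mxE.
    have := congr1 (fun v : 'rV[rat]_q => v 0 j) gz.
    rewrite !mxE => /eqP; rewrite intr_eq0 => /eqP gzj.
    apply/eqP; rewrite eq_le M0 // andbT.
    by have := M0 _ Mz j; rewrite -(lerD2l (g i 0 j)) addr0 gzj.
  move=> /pur /(_ Mgi); rewrite -axy => -[_]; apply.
  by exists 0 => //; rewrite /toQ map_mx0 addr0.
exists [ffun i => Ordinal (ltn_pmod (c i) m0)] => //=.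
congr (_ *: toQ _); rewrite xc; apply: eq_bigr => i _; rewrite ffunE /=.
have [/key ->|cm] := leqP m (c i); first by rewrite !mul0rn.
by rewrite modn_small.
Qed.

(* Main.v *)
(* Write A for A(M), V_m for V_m(M), and y in W_m for y/m in V_m.  Multiplying out
   denominators gives the key monotonicity: if z is in W_k, m is in A, y is in M
   and m z - k y is in M, then y is in W_m.  So the sets V_m, m in A, are the
   traces on (1/m)M of one order ideal, and M \ P(M), the union of the W_m with
   m > 1, is a face of M; Weyl's theorem provides a functional cutting it out.

   Lexicographically least representations split M into finitely many translates
   of free monoids on linearly independent generators.  On such a piece of rank
   s = mpdim(M), seminormality, in the form that lattice points in the relative
   interior of the cone belong to M, makes the condition y in W_m monotone in the
   coordinates up to a bounded shift.  Comparing boxes for m and n gives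
   a_m <= a_n + C/m + C m/n for a_m = |V_m|/m^s, so a_m converges along A; pieces
   of smaller rank are negligible.  A multiple of a point in the relative interior
   of the face gives a_m >= k^-s.  An element m > 1 of A is 1 plus a common
   multiple of the torsion exponents of ZM modulo the groups of the faces.

   If M is normal then V_m is given by 0 <= h <= m - 1 for the primitive facet
   functionals h.  By Gordan's lemma the pairs (y, k) with 0 <= h(y) <= k form a
   finitely generated monoid; split in the same way, its elements with k < n are
   counted by simplices, so the sum of the first n numbers |V_m| is asymptotic
   to a rational multiple of a power of n. *)
Require Import Defs.
From mathcomp Require Import all_boot all_order all_algebra finmap.
From mathcomp Require Import all_classical all_reals all_analysis.
From mathcomp Require Import zify ring lra.
Import Order.TTheory GRing.Theory Num.Theory numFieldNormedType.Exports.
Local Open Scope classical_set_scope.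
Local Open Scope ring_scope.
Set Implicit Arguments. Unset Strict Implicit. Unset Printing Implicit Defensive.

(** * Cardinalities of finite sets, with value 0 on infinite sets *)

Definition ncard (T : choiceType) (A : set T) : nat := #|` fset_set A|.

Lemma ncardE (T : choiceType) (A : set T) :
  finite_set A -> ncard A = (\sum_(x <- fset_set A) 1)%N.
Proof. by move=> fA; rewrite /ncard card_fset_sum1. Qed.

Lemma ncard_le (T : choiceType) (A B : set T) :
  finite_set B -> A `<=` B -> (ncard A <= ncard B)%N.
Proof.
move=> fB AB; apply: fsubset_leq_card.
by rewrite -fset_set_sub //; apply: sub_finite_set fB.
Qed.

Lemma ncard_image (T U : choiceType) (A : set T) (f : T -> U) :
  finite_set A -> (forall x y, A x -> A y -> f x = f y -> x = y) ->
  ncard (f @` A) = ncard A.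
Proof.
move=> fA finj; rewrite /ncard fset_set_image // card_in_imfset //= => x y.
by rewrite !in_fset_set // !inE => Ax Ay; apply: finj.
Qed.

Lemma finite_inj (T U : choiceType) (A : set T) (B : set U) (f : T -> U) :
  finite_set B -> (forall x, A x -> B (f x)) ->
  (forall x y, A x -> A y -> f x = f y -> x = y) -> finite_set A.
Proof.
move=> fB AB finj; have [->|/set0P[x0 Ax0]] := eqVneq A set0 => //.
pose g y := xget x0 [set x | A x /\ f x = y].
apply: (@sub_finite_set _ _ (g @` B)); last exact: finite_image.
move=> x Ax; exists (f x); first exact: AB.
rewrite /g; have : exists x', (A x' /\ f x' = f x) by exists x.
by case/(xgetPex x0) => Ag; apply: finj.
Qed.

Lemma ncard_inj_le (T U : choiceType) (A : set T) (B : set U) (f : T -> U) :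
  finite_set B -> (forall x, A x -> B (f x)) ->
  (forall x y, A x -> A y -> f x = f y -> x = y) -> (ncard A <= ncard B)%N.
Proof.
move=> fB AB finj; rewrite -(ncard_image (f := f)) //; last exact: finite_inj AB finj.
by apply: ncard_le => // _ [x Ax <-]; apply: AB.
Qed.

Lemma ncard_partition (T : choiceType) (U : finType) (A : set T) (p : T -> U) :
  finite_set A -> ncard A = (\sum_u ncard [set x | A x /\ p x = u])%N.
Proof.
move=> fA; rewrite ncardE // (partition_big p predT) //=.
apply: eq_bigr => u _.
have fAu : finite_set [set x | A x /\ p x = u].
  by apply: sub_finite_set fA => x [].
rewrite ncardE // -[LHS]big_filter; apply: perm_big; apply: uniq_perm.
- by rewrite filter_uniq.
- exact: fset_uniq.
move=> x; rewrite mem_filter !in_fset_set //; apply/andP/idP.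
  by rewrite !inE => -[/eqP].
by rewrite !inE => -[? /eqP].
Qed.

Lemma ncardU_le (T : choiceType) (A B : set T) :
  finite_set A -> finite_set B -> (ncard (A `|` B)%classic <= ncard A + ncard B)%N.
Proof. by move=> fA fB; rewrite /ncard fset_setU // cardfsU leq_subr. Qed.

Lemma ncard_cover (T J : choiceType) (s : seq J) (A : set T) (B : J -> set T) :
  (forall j, finite_set (B j)) ->
  (forall x, A x -> exists2 j, j \in s & B j x) ->
  (ncard A <= \sum_(j <- s) ncard (B j))%N.
Proof.
move=> fB; elim: s A => [|j s IH] A cov.
  have -> : A = set0 by apply/seteqP; split=> x // /cov[j]; rewrite in_nil.
  by rewrite /ncard fset_set0.
have fA : finite_set (A `\` B j).
  apply: (@sub_finite_set _ _ (\bigcup_(i in [set` s]) B i)).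
    move=> x [/cov[i]]; rewrite inE => /orP[/eqP -> //|si] Bi _.
    by exists i.
  by apply: bigcup_finite => // i _.
rewrite big_cons; apply: leq_trans (leq_add (leqnn _) (IH (A `\` B j) _)).
  apply: leq_trans (ncardU_le (fB j) fA); apply: ncard_le.
    by rewrite finite_setU.
  by move=> x Ax; have [Bx|nBx] := pselect (B j x); [left|right].
move=> x [/cov[i]]; rewrite inE => /orP[/eqP -> //|si] Bi _.
by exists i.
Qed.

Lemma ncard_pred (T : finType) (p : pred T) : ncard [set x | p x] = #|p|.
Proof.
rewrite ncardE; last exact: finite_finset.
rewrite -sum1_card -[RHS]big_filter; apply: perm_big; apply: uniq_perm.
- exact: fset_uniq.
- by rewrite filter_uniq // index_enum_uniq.
move=> x; rewrite in_fset_set; last exact: finite_finset.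
by rewrite mem_filter mem_index_enum andbT; apply/idP/idP; rewrite ?inE.
Qed.

Lemma ncardX (T U : choiceType) (A : set T) (B : set U) :
  finite_set A -> finite_set B -> ncard (A `*` B) = (ncard A * ncard B)%N.
Proof.
move=> fA fB; rewrite /ncard -(size_allpairs pair); apply: perm_size.
apply: uniq_perm; first exact: fset_uniq.
  by apply: allpairs_uniq; rewrite ?fset_uniq // => -[x y] [x' y'].
move=> [x y]; rewrite in_fset_set; last exact: finite_setX.
apply/idP/allpairsP => [|[[a b] /= [aA bB [-> ->]]]].
  by rewrite inE => -[/= Ax By]; exists (x, y); rewrite !in_fset_set // !inE.
by rewrite !in_fset_set // !inE in aA bB *.
Qed.

(** * Boxes of exponent vectors *)

Section Box.
Variables (I : finType).
Implicit Types a b c : {ffun I -> nat}.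

Definition box (a b : I -> nat) : set {ffun I -> nat} :=
  [set c | forall i, (a i <= c i < a i + b i)%N].

Lemma box_card (a b : I -> nat) :
  finite_set (box a b) /\ ncard (box a b) = (\prod_i b i)%N.
Proof.
pose B := (\max_i (a i + b i))%N.
pose F i := [pred x : 'I_B | (a i <= x < a i + b i)%N].
pose f (c : {ffun I -> 'I_B}) : {ffun I -> nat} := [ffun i => c i : nat].
have boxE : box a b = f @` [set c | c \in family F].
  apply/seteqP; split=> [c cb|_ [c /= /familyP cF <-] i]; last first.
    by have := cF i; rewrite ffunE inE.
  have cB i : (c i < B)%N.
    have /andP[_ /leq_trans] := cb i; apply.
    exact: (@leq_bigmax _ (fun i => (a i + b i)%N) i).
  exists [ffun i => Ordinal (cB i)]; last by apply/ffunP => i; rewrite !ffunE.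
  by apply/familyP => i; rewrite ffunE inE /=; apply: cb.
rewrite boxE; split; first exact: finite_image.
rewrite ncard_image //; last first.
  move=> c c' _ _ /ffunP ff'; apply/ffunP => i; apply/val_inj.
  by have := ff' i; rewrite !ffunE.
rewrite ncard_pred card_family foldrE big_map [in LHS]big_enum /=.
apply: eq_bigr => i _.
have le : (a i + b i <= B)%N by exact: (@leq_bigmax _ (fun i => (a i + b i)%N) i).
have -> : #|F i| = (\sum_(x < B | a i <= x < a i + b i) 1)%N by rewrite sum1_card.
rewrite -(big_mkord (fun x => a i <= x < a i + b i)%N (fun _ => 1%N)).
rewrite (@big_cat_nat _ _ _ (a i)) //=; last by lia.
rewrite big_nat_cond big1 ?add0n; last by move=> x; lia.
rewrite (@big_cat_nat _ _ _ (a i + b i)) //=; last by lia.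
rewrite [X in (_ + X)%N]big_nat_cond [X in (_ + X)%N]big1 ?addn0; last by move=> x; lia.
rewrite big_nat_cond (eq_bigl (fun x => (a i <= x < a i + b i) && true)%N); last first.
  by move=> x /=; rewrite andbb andbT.
by rewrite -big_nat_cond sum_nat_const_nat; lia.
Qed.

End Box.

(** * Dickson's lemma *)

Section Dickson.
Variable I : finType.
Implicit Types c v : {ffun I -> nat}.

(** Induction on the coordinates. For each pattern of values at most [K'] on [s], [T] bounds the
    [j]-th coordinate of one chosen witness, which serves when [T <= c j]; the finitely many slices
    with [c j < T] are covered by the induction hypothesis. *)
Lemma dickson_seq (s : seq I) (P : set {ffun I -> nat}) :
  exists K, forall c, P c -> exists v,
    [/\ P v, forall i, i \in s -> (v i <= c i)%N
      & forall i, i \in s -> (v i <= K)%N].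
Proof.
elim: s P => [|j s IH] P; first by exists 0%N => c Pc; exists c.
have [K' HK'] := IH P.
have [Kt HKt] := choice (fun t => IH [set c | P c /\ c j = t]).
pose Q (p : {ffun I -> 'I_K'.+1}) t :=
  exists v, [/\ P v, forall i, i \in s -> v i = p i & v j = t].
pose tt p := xget 0%N [set t | Q p t].
pose T := (\max_p tt p)%N.
exists (maxn (maxn K' T) (\max_(t < T) Kt t))%N => c Pc.
have [v0 [Pv0 v0c v0K]] := HK' c Pc.
pose p : {ffun I -> 'I_K'.+1} := [ffun i => inord (v0 i)].
have pv0 i : i \in s -> p i = v0 i :> nat.
  by move=> si; rewrite ffunE inordK // ltnS v0K.
have : Q p (tt p).
  have : exists t, Q p t by exists (v0 j), v0; split=> // i /pv0.
  by move/(xgetPex 0%N).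
case=> v1 [Pv1 v1p v1j].
have v1T : (v1 j <= T)%N by rewrite v1j; exact: (@leq_bigmax _ tt p).
have [Tc|cT] := leqP T (c j).
  exists v1; split=> // i; rewrite inE => /orP[/eqP ->|si].
  - exact: leq_trans v1T Tc.
  - by rewrite v1p // pv0 // v0c.
  - by rewrite !leq_max v1T orbT.
  - by rewrite !leq_max v1p // pv0 // v0K.
have [v [[Pv vj] vc vK]] := HKt (c j) c (conj Pc erefl).
exists v; split=> // i; rewrite inE => /orP[/eqP ->|si].
- by rewrite vj.
- exact: vc.
- by rewrite vj !leq_max (ltnW cT) orbT.
- apply: leq_trans (vK i si) _; rewrite !leq_max orbC.
  by rewrite (@leq_bigmax _ (fun t : 'I_T => Kt t) (Ordinal cT)).
Qed.

Lemma dickson (P : set {ffun I -> nat}) :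
  exists K, forall c, P c ->
    exists v, [/\ P v, forall i, (v i <= c i)%N & forall i, (v i <= K)%N].
Proof.
have [K HK] := dickson_seq (enum I) P.
exists K => c /HK[v [Pv vc vK]]; exists v.
by split=> // i; [apply: vc|apply: vK]; rewrite mem_enum.
Qed.

End Dickson.

(** * Standard representations and their decomposition by truncation *)

Section Stanley.
Variables (I : finType) (V : nmodType) (v : I -> V).
Implicit Types c d u : {ffun I -> nat}.

Definition ev (c : {ffun I -> nat}) : V := \sum_i v i *+ c i.

Definition trunc (K : nat) c : {ffun I -> nat} := [ffun i => minn (c i) K].

Lemma evD c d : ev [ffun i => (c i + d i)%N] = ev c + ev d.
Proof.
by rewrite /ev -big_split; apply: eq_bigr => i _; rewrite ffunE mulrnDr.
Qed.

Lemma ev_split c d : (forall i, (c i <= d i)%N) ->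
  ev d = ev c + ev [ffun i => (d i - c i)%N].
Proof.
move=> cd; rewrite -evD; congr ev; apply/ffunP => i.
by rewrite !ffunE subnKC.
Qed.

Lemma evM c k : ev [ffun i => (c i * k)%N] = ev c *+ k.
Proof.
by rewrite /ev -sumrMnl; apply: eq_bigr => i _; rewrite ffunE mulrnA.
Qed.

Lemma ev0 : ev [ffun=> 0%N] = 0.
Proof. by rewrite /ev big1 // => i _; rewrite ffunE. Qed.

Lemma ev1 j : ev [ffun i => (i == j) : nat] = v j.
Proof.
rewrite /ev (bigD1 j) //= ffunE eqxx big1 ?addr0 // => i /negbTE ij.
by rewrite ffunE ij.
Qed.

(** A nonempty fibre of [trunc K] over [u] freezes the coordinates off this set and lets those in it
    take all values from [K] on. *)
Definition trunc_top (K : nat) u : {set I} := [set i | u i == K]%SET.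

Lemma trunc_off K c u : trunc K c = u -> forall i, i \notin trunc_top K u -> c i = u i.
Proof.
move=> <- i; rewrite inE ffunE; case: leqP => //.
by rewrite eqxx.
Qed.

Lemma ncard_trunc_partition K (A : set {ffun I -> nat}) : finite_set A ->
  ncard A = (\sum_(u : {ffun I -> 'I_K.+1})
    ncard [set c | A c /\ trunc K c = [ffun i => u i : nat]])%N.
Proof.
move=> fA; pose p c : {ffun I -> 'I_K.+1} := [ffun i => inord (minn (c i) K)].
rewrite (ncard_partition p fA); apply: eq_bigr => u _; congr ncard.
apply/seteqP; split=> c /= [Ac cu]; split=> //; apply/ffunP => i.
  by rewrite -cu !ffunE inordK // ltnS geq_minr.
apply/val_inj; rewrite ffunE /= inordK ?ltnS ?geq_minr //.
by have /ffunP/(_ i) := cu; rewrite !ffunE.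
Qed.

(** Resetting the exponent of a zero generator to 0 changes neither the value nor membership in [L],
    so injectivity on [L] applies. *)
Lemma standard_zero (L : set {ffun I -> nat}) c i :
  (forall c d, L d -> (forall i, (c i <= d i)%N) -> L c) ->
  (forall c d, L c -> L d -> ev c = ev d -> c = d) ->
  L c -> v i = 0 -> c i = 0%N.
Proof.
move=> Ldown Linj Lc vi; pose d := [ffun j => if j == i then 0%N else c j].
have Ld : L d by apply: Ldown Lc _ => j; rewrite ffunE; case: eqP.
suff -> : c = d by rewrite ffunE eqxx.
apply: Linj => //; rewrite /ev; apply: eq_bigr => j _; rewrite ffunE.
by case: eqP => // ->; rewrite vi !mul0rn.
Qed.

Fixpoint lexlt (s : seq I) c d : bool :=
  if s is j :: s' then (c j < d j)%N || (c j == d j) && lexlt s' c d else false.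

(** One coordinate after another is minimised, each among the minimisers of the earlier ones. *)
Lemma lexlt_min s (P : set {ffun I -> nat}) c0 : P c0 ->
  exists c, P c /\ forall d, P d -> ~~ lexlt s d c.
Proof.
elim: s P c0 => [|j s IH] P c0 Pc0; first by exists c0.
have exP : exists t, `[< exists c, P c /\ c j = t >].
  by exists (c0 j); apply/asboolP; exists c0.
case: (ex_minnP exP) => t /asboolP[c1 [Pc1 c1t]] tmin.
have [c [[Pc ct] cmin]] := IH [set c | P c /\ c j = t] c1 (conj Pc1 c1t).
exists c; split=> // d Pd /=; rewrite negb_or -leqNgt ct.
have tdj : (t <= d j)%N by apply: tmin; apply/asboolP; exists d.
rewrite tdj /=; have [dt|//] := eqVneq (d j) t.
by apply: cmin; split.
Qed.

Lemma lexlt_total s c d : ~~ lexlt s c d -> ~~ lexlt s d c ->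
  forall i, i \in s -> c i = d i.
Proof.
elim: s => [|j s IH] //=.
case: (ltngtP (c j) (d j)) => //= cd h1 h2 i.
by rewrite inE => /orP[/eqP ->|] //; apply: IH.
Qed.

Lemma lexltD s c d u : lexlt s c d ->
  lexlt s [ffun i => (c i + u i)%N] [ffun i => (d i + u i)%N].
Proof.
by elim: s => [|j s IH] //=; rewrite !ffunE ltn_add2r eqn_add2r => /orP[->//|
  /andP[-> /IH ->]]; rewrite orbT.
Qed.

(* The lexicographically least representations form the set of standard
   monomials of the toric ideal; the truncation level comes from Dickson's
   lemma applied to its complement. *)
Lemma standard_representations :
  exists (L : set {ffun I -> nat}) (K : nat),
  [/\ forall c d, L d -> (forall i, (c i <= d i)%N) -> L c,
      forall c d, L c -> L d -> ev c = ev d -> c = d,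
      forall c, exists2 d, L d & ev d = ev c,
      (0 < K)%N
    & forall c, L c <-> L (trunc K c)].
Proof.
pose L := [set c | forall d, ev d = ev c -> ~~ lexlt (enum I) d c].
have Ldown c d : L d -> (forall i, (c i <= d i)%N) -> L c.
  (* Adding [d - c] to [c] and to a smaller representation [c'] of the same value would give a
     representation smaller than [d]. *)
  move=> Ld cd c' c'c; apply/negP => /(lexltD [ffun i => (d i - c i)%N]).
  have -> : [ffun i => (c i + [ffun i => (d i - c i)%N] i)%N] = d.
    by apply/ffunP => i; rewrite !ffunE subnKC.
  by apply/negP/Ld; rewrite evD c'c -ev_split.
have [K HK] := dickson (~` L).
(* An excluded vector below [c] with entries at most [K] also lies below the truncation of [c] at
   [K.+1]; the successor makes the level positive. *)
exists L, K.+1; split=> //.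
- move=> c d Lc Ld cd; apply/ffunP => i.
  apply: (@lexlt_total (enum I)); last by rewrite mem_enum.
    exact: Ld.
  exact: Lc.
- move=> c; have [d [dc dmin]] := @lexlt_min (enum I) [set d | ev d = ev c] c erefl.
  by exists d => // d' d'd; apply: dmin; rewrite /= d'd.
- move=> c; split=> [Lc|Lc].
    by apply: Ldown Lc _ => i; rewrite ffunE geq_minl.
  apply: contrapT => /HK[w [nLw wc wK]]; apply: nLw; apply: Ldown Lc _ => i.
  by rewrite ffunE leq_min wc leqW.
Qed.

End Stanley.

(** * Convergence of almost nondecreasing sequences *)

Section Limit.
Variables (R : realType) (A : nat -> Prop).
Hypothesis A_gt0 : forall n, A n -> (0 < n)%N.

(* The limit of such a sequence along A is sup_m (a m - C / m). *)
Definition almost_nondecreasing (a : nat -> R) := exists C : R, 0 <= C /\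
  forall m, A m -> (0 <= a m <= C) /\
    forall n, A n -> C * m%:R <= n%:R ->
      a m <= a n + C / m%:R + C * m%:R / n%:R.

Lemma almost_nondecreasing0 : almost_nondecreasing (fun=> 0).
Proof.
exists 0; split=> // m Am; split; first by rewrite lexx.
move=> n An _; by rewrite !mul0r !addr0.
Qed.

Lemma almost_nondecreasingD a b : almost_nondecreasing a ->
  almost_nondecreasing b -> almost_nondecreasing (fun n => a n + b n).
Proof.
move=> [C [C0 HC]] [D [D0 HD]]; exists (C + D); split; first exact: addr_ge0.
move=> m Am; have [/andP[a0 aC] Ha] := HC m Am.
have [/andP[b0 bD] Hb] := HD m Am; split; first by apply/andP; split; lra.
move=> n An CDmn.
have Cm : C * m%:R <= n%:R by apply: le_trans CDmn; rewrite ler_wpM2r // lerDl.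
have Dm : D * m%:R <= n%:R by apply: le_trans CDmn; rewrite ler_wpM2r // lerDr.
have := lerD (Ha n An Cm) (Hb n An Dm); rewrite !mulrDl; lra.
Qed.

Lemma almost_nondecreasing_sum (J : finType) (a : J -> nat -> R) :
  (forall j, almost_nondecreasing (a j)) ->
  almost_nondecreasing (fun n => \sum_j a j n).
Proof.
move=> Ha; have -> : (fun n => \sum_j a j n) = \sum_j a j.
  by apply/funext => n; rewrite fct_sumE.
elim/big_ind: _ => // [|b c].
  exact: almost_nondecreasing0.
exact: almost_nondecreasingD.
Qed.

(** For a finite [A] every [l] would qualify, so a proof that the limit is positive has to produce
    arbitrarily large elements of [A]. *)
Definition cvg_along (a : nat -> R) (l : R) :=
  forall e, 0 < e -> exists N, forall n, (N <= n)%N -> A n -> `|a n - l| <= e.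

Lemma nat_large (x : R) : exists N, forall n, (N <= n)%N -> x <= n%:R.
Proof.
exists (Num.bound `|x|) => n Nn.
apply: le_trans (ler_norm x) _; apply: ltW.
apply: lt_le_trans (archi_boundP (normr_ge0 x)) _; by rewrite ler_nat.
Qed.

Lemma almost_nondecreasing_cvg a : (exists m, A m) ->
  almost_nondecreasing a -> exists l, cvg_along a l.
Proof.
move=> [m0 Am0] [C [C0 HC]].
pose X : set R := [set a m - C / m%:R | m in A].
have supX : has_sup X.
  split; first by exists (a m0 - C / m0%:R), m0.
  exists C => _ [m Am <-]; have [/andP[_ aC] _] := HC m Am.
  have : 0 <= C / m%:R by rewrite divr_ge0.
  by lra.
exists (sup X) => e e0.
have [_ [m Am <-] Hm] := sup_adherent (divr_gt0 e0 (ltr0n R 2)) supX.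
have m0' : 0 < m%:R :> R by rewrite ltr0n A_gt0.
(* For such [n] one has [C * m <= n], [C / n <= e] and [C * m / n <= e / 2]; the other [e / 2] was
   spent on the choice of [m]. *)
have [N HN] := nat_large (C * m%:R + 2 * C * m%:R / e + C / e + 1).
exists N => n Nn An; have nN := HN n Nn.
have Cm0 : 0 <= C * m%:R by rewrite mulr_ge0 // ltW.
have h1 : 0 <= 2 * C * m%:R / e by rewrite divr_ge0 ?(ltW e0) // -mulrA mulr_ge0.
have h2 : 0 <= C / e by rewrite divr_ge0 // ltW.
have n0 : 0 < n%:R :> R by rewrite ltr0n A_gt0.
have le1 : C / n%:R <= e.
  by rewrite ler_pdivrMr // [leRHS]mulrC -ler_pdivrMr //; lra.
have le2 : C * m%:R / n%:R <= e / 2.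
  rewrite ler_pdivrMr // [leRHS]mulrC -ler_pdivrMr; last by rewrite divr_gt0.
  by rewrite invf_div mulrA; lra.
have Xn : a n - C / n%:R <= sup X by apply: sup_upper_bound => //; exists n.
have [_ /(_ n An)] := HC m Am.
move=> /(_ ltac:(lra)) Hmn.
by rewrite ler_norml; apply/andP; split; lra.
Qed.

End Limit.

(** * Comparison of lattice point counts by cubes *)

Section Cube.
Variables (R : realType) (I : finType) (A : nat -> Prop).
Hypothesis A_gt0 : forall n, A n -> (0 < n)%N.
(* J is the set of free coordinates; the others are frozen to those of u. *)
Variables (J : {set I}) (u : {ffun I -> nat}) (K t : nat).
Variable E : nat -> set {ffun I -> nat}.
Hypothesis E_lt : forall m c, A m -> E m c -> forall i, (c i < m)%N.
Hypothesis E_off : forall m c, A m -> E m c -> forall i, i \notin J -> c i = u i.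

Let fJ (k l : nat) (i : I) := if i \in J then k else l.

Lemma prod_fJ k : (\prod_i fJ k 1 i = k ^ #|J|)%N.
Proof.
by rewrite -big_mkcond /= prod_nat_const.
Qed.

Lemma E_sub m : A m -> E m `<=` box (fun i => if i \in J then 0 else u i)%N (fJ m 1).
Proof.
move=> Am c Ec i; rewrite /fJ; case: ifPn => iJ.
  by rewrite add0n; exact: (E_lt Am Ec i).
by rewrite (E_off Am Ec iJ) leqnn addn1 ltnSn.
Qed.

Lemma E_finite m : A m -> finite_set (E m).
Proof. by move=> Am; apply: sub_finite_set (E_sub Am) (box_card _ _).1. Qed.

Lemma E_card m : A m -> (ncard (E m) <= m ^ #|J|)%N.
Proof.
move=> Am; rewrite -prod_fJ.
have [fin <-] := box_card (fun i => if i \in J then 0 else u i)%N (fJ m 1).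
exact: ncard_le (E_sub Am).
Qed.

(** With [c j] at least 2, [k * (c j - 1) - t] is still at least [K] as soon as [t + K <= k]. *)
Definition inner m : set {ffun I -> nat} :=
  [set c | E m c /\ forall j, j \in J -> (2 <= c j)%N].

(** For each free coordinate at most [2 * m ^ (#|J| - 1)] points have that coordinate 0 or 1; the
    factor [m] avoids the truncated exponent. *)
Lemma E_inner m : A m ->
  (m * ncard (E m) <= m * ncard (inner m) + #|J| * (2 * m ^ #|J|))%N.
Proof.
move=> Am.
pose b j i := if i == j then 2%N else fJ m 1 i.
pose B j := box (fun i => if i \in J then 0 else u i)%N (b j).
pose E' j := E m `&` B j.
have finE' j : finite_set (E' j) by apply: finite_setIl; apply: E_finite.
have finin : finite_set (inner m).
  by apply: sub_finite_set (E_finite Am) => c [].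
have le1 : (ncard (E m) <= ncard (inner m) + \sum_(j <- enum J) ncard (E' j))%N.
  pose B' (o : option I) := if o is Some j then E' j else inner m.
  have := @ncard_cover _ _ (None :: map Some (enum J)) (E m) B'.
  rewrite big_cons big_map; apply; first by case.
  move=> c Ec; have [c2|] := pselect (forall j, j \in J -> (2 <= c j)%N).
    by exists None; rewrite ?inE.
  move=> /existsNP[j] /not_implyP[jJ /negP]; rewrite -ltnNge => cj.
  exists (Some j); first by rewrite inE /= mem_map ?mem_enum //; apply: Some_inj.
  split=> // i; rewrite /b; have [->|ij] := eqVneq i j.
    by rewrite jJ add0n.
  exact: (E_sub Am Ec i).
have le2 j : j \in J -> (m * ncard (E' j) <= 2 * m ^ #|J|)%N.
  move=> jJ; have [finB cB] := box_card (fun i => if i \in J then 0 else u i)%N (b j).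
  have : (ncard (E' j) <= \prod_i b j i)%N.
    by rewrite -cB; apply: ncard_le => // c [].
  rewrite (bigD1 j) //= {1}/b eqxx => le.
  rewrite -prod_fJ (bigD1 j) //= {1}/fJ jJ mulnCA leq_mul2l; apply/orP; right.
  apply: leq_trans le _; rewrite leq_mul2l /=.
  by apply/eq_leq/eq_bigr => i /negbTE ij; rewrite /b ij.
apply: leq_trans (leq_mul (leqnn m) le1) _; rewrite mulnDr leq_add2l.
rewrite big_distrr /= big_enum /= -sum_nat_const.
by apply: leq_sum => j; apply: le2.
Qed.

(** In the free coordinates the last condition reads (c' + t) / n <= c / m: after rescaling, the
    sets form one order ideal up to the shift [t]. *)
Hypothesis E_mono : forall m n (c c' : {ffun I -> nat}), A m -> A n -> E m c ->
  (forall i, i \notin J -> c' i = u i) -> (forall j, j \in J -> (K <= c' j)%N) ->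
  (forall j, j \in J -> (m * (c' j + t) <= n * c j)%N) -> E n c'.

(* Below each point c of E m lie (n %/ m) ^ #|J| points of E n. *)
Lemma E_inner_le m n : A m -> A n -> (t + K <= n %/ m)%N ->
  (ncard (inner m) * (n %/ m) ^ #|J| <= ncard (E n))%N.
Proof.
move=> Am An; have [k kE] : exists k, k = (n %/ m)%N by eexists.
rewrite -kE => tKk; have kmn : (k * m <= n)%N by rewrite kE leq_divM.
clear kE.
pose Z := box (fun=> 0%N) (fJ k 1).
have [finZ cZ] := box_card (fun=> 0%N) (fJ k 1); rewrite -/Z in finZ cZ.
have finin : finite_set (inner m).
  by apply: sub_finite_set (E_finite Am) => c [].
have -> : (ncard (inner m) * k ^ #|J| = ncard (inner m `*` Z))%N.
  by rewrite ncardX // cZ prod_fJ.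
(* In a free coordinate, [p.1 - 1] and [p.2] are quotient and remainder modulo [k] of the image plus
   [t], whence injectivity; [k * m <= n] gives the inequality of [E_mono]. *)
pose f (p : {ffun I -> nat} * {ffun I -> nat}) : {ffun I -> nat} :=
  [ffun i => if i \in J then k * (p.1 i - 1) + p.2 i - t else u i]%N.
have Zk r j : Z r -> j \in J -> (r j < k)%N.
  by move=> /(_ j); rewrite /fJ => + jJ; rewrite jJ add0n.
have ck c j : inner m c -> j \in J -> (k <= k * (c j - 1))%N.
  by move=> [_ c2] jJ; rewrite leq_pmulr // subn_gt0 c2.
apply: (ncard_inj_le (f := f)); first exact: E_finite.
  move=> [c r] [ic Zr]; rewrite /= in ic Zr; have [Ec c2] := ic.
  apply: (E_mono Am An Ec) => j jJ; rewrite ffunE ?(negbTE jJ) // jJ /=.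
    have := ck c j ic jJ; lia.
  have kc := ck c j ic jJ; rewrite subnK; last by lia.
  have /ltnW rk := Zk r j Zr jJ.
  apply: (@leq_trans (m * (k * c j))%N); last by rewrite mulnA (mulnC m) leq_mul2r kmn orbT.
  rewrite leq_mul2l; apply/orP; right.
  have -> : (k * c j = k * (c j - 1) + k)%N.
    by rewrite -mulnSr; congr (_ * _)%N; have c2j : (2 <= c j)%N := c2 j jJ; lia.
  by rewrite leq_add2l.
move=> [c r] [c' r'] [ic Zr] [ic' Zr'] ff.
rewrite /= in ic Zr ic' Zr' ff.
have key j : j \in J -> c j = c' j /\ r j = r' j.
  move=> jJ; have := congr1 (fun g : {ffun I -> nat} => g j) ff.
  rewrite !ffunE jJ /= => e.
  have h1 := ck c j ic jJ; have h2 := ck c' j ic' jJ.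
  have h3 := Zk r j Zr jJ; have h4 := Zk r' j Zr' jJ.
  have arith a b x y : (k <= a -> k <= b -> a + x - t = b + y - t ->
    a + x = b + y)%N by lia.
  have {e}e := arith _ _ _ _ h1 h2 e.
  have k0 : (0 < k)%N by apply: leq_ltn_trans h3.
  have : ((k * (c j - 1) + r j) %/ k = (k * (c' j - 1) + r' j) %/ k)%N by rewrite e.
  rewrite !(mulnC k) !divnMDl // !divn_small // !addn0 => e1.
  have c1 : (2 <= c j)%N := ic.2 j jJ; have c1' : (2 <= c' j)%N := ic'.2 j jJ.
  split; last by move/eqP: e; rewrite e1 eqn_add2l => /eqP.
  by rewrite -(subnK (ltnW c1)) e1 subnK // ltnW.
congr (_, _); apply/ffunP => i; have [iJ|iJ] := boolP (i \in J).
- by case: (key i iJ).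
- by rewrite (E_off Am ic.1 iJ) (E_off Am ic'.1 iJ).
- by case: (key i iJ).
have := Zr i; have := Zr' i; rewrite /fJ (negbTE iJ) !add0n !ltnS !leqn0.
by move=> /eqP -> /eqP ->.
Qed.

Lemma E_almost_nondecreasing :
  almost_nondecreasing A (fun m => (ncard (E m))%:R / m%:R ^+ #|J| : R).
Proof.
set d := #|J|.
(* [d * 2] pays for the points outside [inner], [d] for Bernoulli's inequality below, and [t + K]
   makes [C * m <= n] imply [t + K <= n %/ m]. *)
pose C : R := (d * 2 + d + t + K + 2)%:R.
have C1 : 1 <= C by rewrite /C ler1n; lia.
have C2 : d%:R * 2 <= C by rewrite -natrM ler_nat; lia.
have C3 : d%:R <= C by rewrite ler_nat; lia.
have a01 m : A m -> 0 <= ((ncard (E m))%:R / m%:R ^+ d : R) <= 1.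
  move=> Am; have m0 : 0 < m%:R :> R by rewrite ltr0n A_gt0.
  rewrite divr_ge0 ?exprn_ge0 //= ler_pdivrMr ?exprn_gt0 // mul1r.
  by rewrite -natrX ler_nat E_card.
exists C; split; first by apply: le_trans C1.
move=> m Am; have m0 : 0 < m%:R :> R by rewrite ltr0n A_gt0.
split; first by case/andP: (a01 m Am) => -> /= /le_trans; apply.
move=> n An Cmn; have n0 : 0 < n%:R :> R by rewrite ltr0n A_gt0.
set k := (n %/ m)%N.
have m0N := A_gt0 Am.
have tKk : (t + K <= k)%N.
  move: Cmn; rewrite -natrM ler_nat => Cmn.
  by rewrite leq_divRL //; apply: leq_trans Cmn; rewrite leq_mul2r; apply/orP; right; lia.
have := E_inner Am; have := E_inner_le Am An tKk; rewrite -/k -/d.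
set N1 := ncard (inner m) => h1 h2.
rewrite -(ler_nat R) natrM natrX in h1.
rewrite -(ler_nat R) natrD !natrM natrX in h2.
move: h1 h2.
set en : R := (ncard (E n))%:R; set em : R := (ncard (E m))%:R => h1 h2.
(* The loss from rounding [n / m] down: [x] lies between [1 - m / n] and 1, so by Bernoulli [x ^+ d]
   is at least [1 - d * (m / n)]. *)
pose x : R := k%:R * m%:R / n%:R.
have xle : 1 - m%:R / n%:R <= x.
  rewrite /x lerBlDr -mulrDl ler_pdivlMr // mul1r -natrM -natrD ler_nat.
  by rewrite [leqLHS](divn_eq n m) leq_add2l ltnW // ltn_pmod.
have x1 : x <= 1.
  by rewrite /x ler_pdivrMr // mul1r -natrM ler_nat leq_divM.
have x0 : 0 <= x by rewrite /x divr_ge0 // ?mulr_ge0.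
have bern p y e : 0 <= y <= 1 -> 1 - e <= y -> 0 <= e -> 1 - p%:R * e <= y ^+ p :> R.
  move=> /andP[y0 y1] ey e0; elim: p => [|p IH]; first by rewrite mul0r subr0 expr0.
  rewrite exprS -natr1 mulrDl mul1r.
  have p0 : 0 <= p%:R :> R by [].
  have yp : y ^+ p <= 1 by rewrite exprn_ile1.
  have yp0 : 0 <= y ^+ p by rewrite exprn_ge0.
  nra.
have hx := bern d x (m%:R / n%:R) ltac:(by rewrite x0) xle ltac:(by rewrite divr_ge0).
have md0 : 0 < m%:R ^+ d :> R by rewrite exprn_gt0.
have nd0 : 0 < n%:R ^+ d :> R by rewrite exprn_gt0.
have g1 : N1%:R / m%:R ^+ d * x ^+ d <= en / n%:R ^+ d.
  rewrite /x expr_div_n exprMn ler_pdivlMr //.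
  have -> : N1%:R / m%:R ^+ d * (k%:R ^+ d * m%:R ^+ d / n%:R ^+ d) * n%:R ^+ d
    = N1%:R * k%:R ^+ d :> R.
    by field; rewrite !gt_eqF.
  exact: h1.
have g2 : em / m%:R ^+ d <= N1%:R / m%:R ^+ d + d%:R * 2 / m%:R.
  rewrite -(ler_pM2l (mulr_gt0 m0 md0)).
  have -> : m%:R * m%:R ^+ d * (em / m%:R ^+ d) = m%:R * em.
    by field; rewrite gt_eqF.
  have -> : m%:R * m%:R ^+ d * (N1%:R / m%:R ^+ d + d%:R * 2 / m%:R)
    = m%:R * N1%:R + d%:R * (2 * m%:R ^+ d) :> R.
    by field; rewrite !gt_eqF.
  exact: h2.
have N1d : 0 <= N1%:R / m%:R ^+ d :> R by rewrite divr_ge0 // ltW.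
have N1d1 : N1%:R / m%:R ^+ d <= 1 :> R.
  rewrite ler_pdivrMr // mul1r -natrX ler_nat; apply: leq_trans (E_card Am).
  by apply: ncard_le; [exact: E_finite|move=> c []].
have mn0 : 0 <= m%:R / n%:R :> R by rewrite divr_ge0.
have d0 : 0 <= d%:R :> R by [].
have f1 : d%:R * 2 / m%:R <= C / m%:R by rewrite ler_pM2r // invr_gt0.
have f2 : d%:R * (m%:R / n%:R) <= C * m%:R / n%:R by rewrite -mulrA ler_wpM2r.
have f3 := ler_wpM2l N1d hx.
have f4 : N1%:R / m%:R ^+ d * (d%:R * (m%:R / n%:R)) <= d%:R * (m%:R / n%:R) :> R.
  by apply: ler_piMl => //; rewrite mulr_ge0.
rewrite mulrBr mulr1 in f3; lra.
Qed.

End Cube.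

(** * Common denominators, and affine monoids in a rational vector space *)

Lemma common_denominator (T : finType) (f : T -> rat) :
  exists2 e, (0 < e)%N & forall t, exists z : int, e%:R * f t = z%:~R.
Proof.
exists (\prod_t `|denq (f t)|)%N.
  by rewrite prodn_gt0 // => t; rewrite absz_gt0 denq_neq0.
move=> t; rewrite (bigD1 t) //= natrM mulrAC.
exists (numq (f t) * (\prod_(i | i != t) `|denq (f i)|)%N%:Z).
by rewrite intrM numqE (mulrC (f t)) [(`|_|%N)%:R]pmulrn absz_denq.
Qed.

Section Monoid.
Variables (I : finType) (V : vectType rat) (v : I -> V).
Implicit Types (x y z : V) (c u : {ffun I -> nat}).

(* For the generators v of M, moved to the rational vector space: MM v, ZZ v,
   AA v and SS v are M, ZM, A(M) and M minus its pure prime, and W v m is m V_m. *)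
Definition MM x := exists c, x = ev v c.
Definition ZZ x := exists y z, [/\ MM y, MM z & x = y - z].

Lemma MM_ev c : MM (ev v c). Proof. by exists c. Qed.

Lemma MM0 : MM 0.
Proof. by exists [ffun=> 0%N]; rewrite ev0. Qed.

Lemma MMD x y : MM x -> MM y -> MM (x + y).
Proof. by move=> [c ->] [d ->]; rewrite -evD; apply: MM_ev. Qed.

Lemma MMn x k : MM x -> MM (x *+ k).
Proof. by move=> [c ->]; rewrite -evM; apply: MM_ev. Qed.

Lemma MMv i : MM (v i).
Proof. by rewrite -(ev1 v i); apply: MM_ev. Qed.

Lemma MM_ZZ x : MM x -> ZZ x.
Proof. by move=> Mx; exists x, 0; split=> //; [exact: MM0|rewrite subr0]. Qed.

Lemma ZZ0 : ZZ 0. Proof. exact/MM_ZZ/MM0. Qed.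

Lemma ZZN x : ZZ x -> ZZ (- x).
Proof. by move=> [y [z [My Mz ->]]]; exists z, y; rewrite opprB. Qed.

Lemma ZZD x y : ZZ x -> ZZ y -> ZZ (x + y).
Proof.
move=> [a [b [Ma Mb ->]]] [c [d [Mc Md ->]]]; exists (a + c), (b + d).
by split; [exact: MMD|exact: MMD|rewrite opprD addrACA].
Qed.

Lemma ZZB x y : ZZ x -> ZZ y -> ZZ (x - y).
Proof. by move=> Zx Zy; apply/ZZD/ZZN. Qed.

Lemma ZZn x k : ZZ x -> ZZ (x *+ k).
Proof.
move=> [y [z [My Mz ->]]]; exists (y *+ k), (z *+ k).
by rewrite mulrnBl; split=> //; apply: MMn.
Qed.

Lemma ZZz x (k : int) : ZZ x -> ZZ (x *~ k).
Proof. by case: k => k Zx; [apply: ZZn|apply/ZZN/ZZn]. Qed.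

Lemma ev_int c : ev v c = \sum_i v i *~ (c i)%:Z.
Proof. by []. Qed.

Lemma ZZ_int x : ZZ x <-> exists a : I -> int, x = \sum_i v i *~ a i.
Proof.
split=> [[_ [_ [[c ->] [d ->] ->]]]|[a ->]].
  exists (fun i => (c i)%:Z - (d i)%:Z).
  by rewrite /ev -sumrB; apply: eq_bigr => i _; rewrite mulrzBr.
elim/big_ind: _ => [|x' y'|i _]; [exact: ZZ0|exact: ZZD|].
by apply/ZZz/MM_ZZ/MMv.
Qed.

Lemma MM_int (a : I -> int) : (forall i, 0 <= a i) -> MM (\sum_i v i *~ a i).
Proof.
move=> a0; exists [ffun i => `|a i|%N]; apply: eq_bigr => i _.
by rewrite ffunE -[in LHS](gez0_abs (a0 i)).
Qed.

Definition W m y := MM y /\ forall d, ZZ d -> MM (d *+ m + y) -> MM d.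
Definition AA m := (0 < m)%N /\ forall x, ZZ x -> MM (x *+ m) -> MM x.

Lemma AA1 : AA 1. Proof. by []. Qed.

Lemma AAM m n : AA m -> AA n -> AA (m * n).
Proof.
move=> [m0 Am] [n0 An]; split; first by rewrite muln_gt0 m0.
by move=> x Zx; rewrite mulrnA => /An Mx; apply: Am => //; apply/Mx/ZZn.
Qed.

(** Adding [y] to an element [x *+ m] of M brings the condition of [W] to bear. Thus V_m is empty
    for positive m outside A. *)
Lemma W_AA m y : (0 < m)%N -> W m y -> AA m.
Proof. by move=> m0 [My Wy]; split=> // x Zx Mx; apply: Wy => //; apply: MMD. Qed.

Lemma W0 m : AA m -> W m 0.
Proof. by move=> [m0 Am]; split=> [|d Zd]; [exact: MM0|rewrite addr0; apply: Am]. Qed.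

(** If [d *+ m + y] is in M, so is [k] times it plus [z *+ m - y *+ k], which equals [m] times
    [d *+ k + z]. Now [AA m] removes the factor [m], and [W k z] yields [d]. *)
Lemma W_down k z m y : W k z -> AA m -> MM y -> MM (z *+ m - y *+ k) -> W m y.
Proof.
move=> [Mz Wz] [m0 Am] My Mzy; split=> // d Zd Md.
apply: Wz => //; apply: Am; first by apply: ZZD; [exact: ZZn|exact: MM_ZZ].
have -> : (d *+ k + z) *+ m = (d *+ m + y) *+ k + (z *+ m - y *+ k).
  by rewrite !mulrnDl -!mulrnA (mulnC k) addrA addrAC addrK.
by apply: MMD => //; apply: MMn.
Qed.

Definition SS x := exists2 m, (1 < m)%N & W m x.

Lemma SS_MM x : SS x -> MM x. Proof. by case=> m _ []. Qed.

Lemma SS_down x y : SS (x + y) -> MM x -> MM y -> SS x.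
Proof.
move=> [m m1 Wxy] Mx My; exists m => //.
apply: (W_down Wxy) => //; first by apply: W_AA Wxy; apply: ltnW.
by rewrite -mulrnBl addrAC subrr add0r; apply: MMn.
Qed.

(** For x in W_m and y in W_n the element n x + y lies in W_(m n), and x + y is a summand of it. *)
Lemma SSD x y : SS x -> SS y -> SS (x + y).
Proof.
move=> [m m1 [Mx Wx]] [n n1 [My Wy]].
have : SS (x + y + x *+ n.-1).
  exists (m * n)%N; first exact: (ltn_mul m1 n1).
  split; first by do ?apply: MMD => //; apply: MMn.
  move=> d Zd Md; apply: Wx => //; apply: Wy; first by apply: ZZD; [exact: ZZn|exact: MM_ZZ].
  rewrite mulrnDl -mulrnA -addrA.
  by have -> : x *+ n + y = x + y + x *+ n.-1
    by rewrite addrAC -mulrS prednK // ltnW.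
by move/SS_down; apply; [apply: MMD|apply: MMn].
Qed.

Lemma SSn x k : SS x -> (0 < k)%N -> SS (x *+ k).
Proof.
move=> Sx; elim: k => // -[_ _|k IH _]; first by rewrite mulr1n.
by rewrite mulrS; apply: SSD => //; apply: IH.
Qed.

Lemma SSn_inv x k : MM x -> SS (x *+ k) -> (0 < k)%N -> SS x.
Proof.
move=> Mx; case: k => // k; rewrite mulrS => /SS_down + _; apply=> //.
exact: MMn.
Qed.

Definition SI : {set I} := [set i | `[< SS (v i) >]].

Lemma SIP i : reflect (SS (v i)) (i \in SI).
Proof. by rewrite inE; apply: asboolP. Qed.

Lemma ev_pull c i k : (k <= c i)%N ->
  exists2 x, MM x & ev v c = v i *+ k + x.
Proof.
move=> kc; pose c1 := [ffun j => if j == i then k else 0%N].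
exists (ev v [ffun j => (c j - c1 j)%N]); first exact: MM_ev.
rewrite (@ev_split _ _ v c1) => [|j]; last by rewrite ffunE; case: eqP => [->|].
congr (_ + _); rewrite /ev (bigD1 i) //= ffunE eqxx big1 ?addr0 // => j /negbTE ji.
by rewrite ffunE ji.
Qed.

(** [SS] is closed under sums and summands, so membership is read off the support. If A has no
    element above 1, [SS] is empty, hence the hypothesis. *)
Lemma SS_ev c : SS 0 -> SS (ev v c) <-> forall i, (0 < c i)%N -> i \in SI.
Proof.
move=> S0; split=> [Sc i ci|cS].
  have [x Mx cE] := ev_pull ci; apply/SIP.
  by move: Sc; rewrite cE mulr1n => /SS_down; apply=> //; apply: MMv.
rewrite /ev; elim/big_ind: _ => [//|x y|i _]; first exact: SSD.
have [->|ci] := posnP (c i); first by rewrite mulr0n.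
by apply: SSn => //; apply/SIP/cS.
Qed.

(** * Consequences of seminormality *)

Section Seminormal.
Hypothesis SN : forall x, ZZ x -> MM (x *+ 2) -> MM (x *+ 3) -> MM x.

(** Downward induction: once all multiples of [x] from [k + 1] on lie in M, so do the double and the
    triple of [x *+ k], and seminormality gives [x *+ k]. *)
Lemma MM_large_multiples x k0 : ZZ x ->
  (forall k, (k0 <= k)%N -> MM (x *+ k)) -> MM x.
Proof.
move=> Zx Mk; suff /(_ k0 1%N) : forall j k, (0 < k)%N -> (k0 <= k + j)%N -> MM (x *+ k).
  by rewrite mulr1n; apply=> //; rewrite leq_addl.
elim=> [|j IH] k kpos kj; first by apply: Mk; rewrite -(addn0 k).
by apply: SN; [exact: ZZn|..]; rewrite -mulrnA; apply: IH; lia.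
Qed.

(* The hypotheses say that x is a lattice point in the relative interior of the
   cone over the support of c. *)
Lemma MM_interior x k (a : I -> int) c : (0 < k)%N ->
  x = \sum_i v i *~ a i -> x *+ k = ev v c -> (forall i, c i = 0%N -> a i = 0) ->
  MM x.
Proof.
(* From this threshold on the quotient [Q] of [j] by [k] is at least [k] times the sum of all
   [|a i|], so [Q] copies of [c] outweigh the fewer than [k] copies of [a] left by the remainder. *)
move=> k0 xa xc ac; apply: (@MM_large_multiples _ (k * k * \sum_i `|a i|)%N).
  by apply/ZZ_int; exists a.
move=> j jle; rewrite (divn_eq j k) mulrnDr mulnC mulrnA xc.
set Q := (j %/ k)%N; set r := (j %% k)%N.
have QK : (k * \sum_i `|a i| <= Q)%N by rewrite leq_divRL // mulnAC.
have -> : ev v c *+ Q + x *+ r = \sum_i v i *~ ((c i * Q)%N%:Z + a i * r%:Z).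
  rewrite -evM /ev xa -sumrMnl -big_split; apply: eq_bigr => i _ /=.
  by rewrite ffunE mulrzDr mulrzA.
apply: MM_int => i; have [/eqP|ci] := posnP (c i).
  by move/eqP => ci; rewrite ac // ci mul0n mul0r.
have ai : (`|a i| <= \sum_i `|a i|)%N by rewrite (bigD1 i) //= leq_addr.
have rk : (r < k)%N by rewrite ltn_mod.
have h : (`|a i| * r <= c i * Q)%N.
  apply: leq_trans (leq_pmull Q ci); apply: leq_trans QK.
  by rewrite mulnC leq_mul // ltnW.
have h1 : - (`|a i|%N%:Z) <= a i by lia.
have h2 : - (`|a i|%N%:Z) * r%:Z <= a i * r%:Z by rewrite ler_wpM2r.
have h3 : `|a i|%N%:Z * r%:Z <= (c i * Q)%N%:Z by rewrite -PoszM lez_nat.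
lra.
Qed.

(** [coord] is linear on the whole space, so a common denominator for the coordinates of the
    generators clears those of every element of ZM. *)
Lemma torsion_exponent (J : {set I}) : exists2 e, (0 < e)%N &
  forall x, ZZ x -> x \in <<[seq v i | i <- enum J]>>%VS ->
  exists2 a : I -> int, (forall i, i \notin J -> a i = 0)
    & x *+ e = \sum_i v i *~ a i.
Proof.
pose X := map_tuple v (enum_tuple J).
have [e e0 He] := common_denominator (fun p : I * 'I_#|J| => coord X p.2 (v p.1)).
have [b Hb] := choice (fun p => He p).
exists e => // x /ZZ_int[z xz] xX.
pose a i := if [pick j : 'I_#|J| | enum_val j == i] is Some j
  then \sum_k z k * b (k, j) else 0.
exists a => [i iJ|].
  rewrite /a; case: pickP => // j /eqP ji.
  by move: iJ; rewrite -ji enum_valP.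
have -> : \sum_i v i *~ a i = \sum_(i in J) v i *~ a i.
  rewrite [RHS]big_mkcond; apply: eq_bigr => i _.
  case: ifPn => // iJ; rewrite /a; case: pickP => // j /eqP ji.
  by move: iJ; rewrite -ji enum_valP.
rewrite [RHS]big_enum_val /= -scaler_nat {1}(coord_span (X := X) xX) scaler_sumr.
apply: eq_bigr => j _; rewrite scalerA.
have -> : a (enum_val j) = \sum_k z k * b (k, j).
  by rewrite /a; case: pickP => [j' /eqP/enum_val_inj -> //|/(_ j)]; rewrite eqxx.
have -> : X`_j = v (enum_val j).
  by rewrite (nth_map (enum_val j)) -?cardE // -enum_val_nth.
rewrite -scaler_int; congr (_ *: _).
rewrite xz linear_sum mulr_sumr rmorph_sum; apply: eq_bigr => k _ /=.
by rewrite rmorphM /= -(Hb (k, j)) /= -scaler_int linearZ /= mulrCA.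
Qed.

Lemma exists_AA : exists2 m, (1 < m)%N & AA m.
Proof.
have HE J : exists e, (0 < e)%N /\
    forall x, ZZ x -> x \in <<[seq v i | i <- enum (J : {set I})]>>%VS ->
    exists2 a : I -> int, (forall i, i \notin J -> a i = 0)
      & x *+ e = \sum_i v i *~ a i.
  by have [e] := torsion_exponent J; exists e.
have [e He] := choice HE.
pose E := (\prod_J e J)%N.
have E0 : (0 < E)%N by rewrite prodn_gt0 // => J; case: (He J).
exists E.+1 => //; split=> // x Zx [c xc].
pose J : {set I} := [set i | (0 < c i)%N]%SET.
have [eJ0 HJ] := He J.
have xJ : x \in <<[seq v i | i <- enum J]>>%VS.
  have -> : x = (E.+1)%:R^-1 *: ev v c.
    by rewrite -xc -scaler_nat scalerA mulVf ?scale1r // pnatr_eq0.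
  apply/memvZ/memv_suml => i _; have [->|ci] := posnP (c i).
    by rewrite mulr0n mem0v.
  by apply/rpredMn/memv_span/map_f; rewrite mem_enum inE.
have [a aJ xe] := HJ x Zx xJ.
pose l := (\prod_(K | K != J) e K)%N.
have El : E = (e J * l)%N by rewrite /E (bigD1 J).
(* The difference of [x *+ E.+1] and [x *+ E] is an integer combination supported where [c] is: the
   first is [ev v c], and [E] is a multiple of the exponent for [J]. *)
apply: (@MM_interior x E.+1 (fun i => (c i)%:Z - a i * l%:Z) c) => //.
  have -> : x = x *+ E.+1 - x *+ E by rewrite mulrS addrK.
  rewrite xc El mulrnA xe ev_int -sumrMnl -sumrB; apply: eq_bigr => i _.
  by rewrite mulrzBr mulrzA.
by move=> i ci; rewrite ci aJ ?mul0r ?subr0 // inE ci.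
Qed.

End Seminormal.
End Monoid.

(** * Linear independence of generators *)

Section FreeFamilies.
Variables (I : finType) (V : vectType rat) (v : I -> V).
Implicit Types (J : {set I}) (c d : {ffun I -> nat}).

(** Clearing denominators turns a rational relation into an integer one. *)
Lemma free_intP J :
  (forall a : I -> int, (forall i, i \notin J -> a i = 0) ->
     \sum_i v i *~ a i = 0 -> forall i, a i = 0) ->
  free [seq v i | i <- enum J].
Proof.
move=> indep; pose X := map_tuple v (enum_tuple J).
suff : free X by []; apply/freeP => k k0 j.
have Xv (j' : 'I_#|J|) : X`_j' = v (enum_val j').
  by rewrite (nth_map (enum_val j')) -?cardE // -enum_val_nth.
have [e e0 He] := common_denominator k.
have [z Hz] := choice He.
pose a i := if [pick j : 'I_#|J| | enum_val j == i] is Some j then z j else 0.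
have aE j' : a (enum_val j') = z j'.
  by rewrite /a; case: pickP => [j'' /eqP/enum_val_inj -> //|/(_ j')]; rewrite eqxx.
have aJ i : i \notin J -> a i = 0.
  rewrite /a; case: pickP => // j' /eqP ji.
  by rewrite -ji enum_valP.
have a0 : \sum_i v i *~ a i = 0.
  have -> : \sum_i v i *~ a i = \sum_(i in J) v i *~ a i.
    by rewrite [RHS]big_mkcond; apply: eq_bigr => i _; case: ifPn => // /aJ ->.
  transitivity (e%:R *: \sum_j k j *: X`_j); last by rewrite k0 scaler0.
  rewrite big_enum_val /= scaler_sumr.
  by apply: eq_bigr => j' _; rewrite aE Xv scalerA Hz scaler_int.
have := indep a aJ a0 (enum_val j); rewrite aE => z0.
have /eqP := Hz j; rewrite z0 mulf_eq0 pnatr_eq0 -leqn0 leqNgt e0 /=.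
by move/eqP.
Qed.

Lemma free_ev_inj J c d : free [seq v i | i <- enum J] ->
  (forall i, i \notin J -> c i = d i) -> ev v c = ev v d -> c = d.
Proof.
move=> fr cd /eqP; rewrite -subr_eq0 /ev -sumrB => /eqP e0.
pose X := map_tuple v (enum_tuple J).
have Xv (j' : 'I_#|J|) : X`_j' = v (enum_val j').
  by rewrite (nth_map (enum_val j')) -?cardE // -enum_val_nth.
pose k (j : 'I_#|J|) : rat := (c (enum_val j))%:R - (d (enum_val j))%:R.
have k0 : \sum_j k j *: X`_j = 0.
  rewrite -[RHS]e0.
  have -> : \sum_i (v i *+ c i - v i *+ d i) = \sum_(i in J) (v i *+ c i - v i *+ d i).
    by rewrite [RHS]big_mkcond; apply: eq_bigr => i _; case: ifPn => // /cd ->; rewrite subrr.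
  rewrite [RHS]big_enum_val /=; apply: eq_bigr => j _.
  by rewrite Xv scalerBl !scaler_nat.
have /freeP/(_ k k0) {}k0 : free X := fr.
apply/ffunP => i; have [iJ|/cd //] := boolP (i \in J).
have := k0 (enum_rank_in iJ i); rewrite /k enum_rankK_in // => /eqP.
by rewrite subr_eq0 eqr_nat => /eqP.
Qed.

Lemma free_subset (s : seq I) : exists2 J : {set I}, {subset J <= s} &
  free [seq v i | i <- enum J] /\
  <<[seq v i | i <- enum J]>>%VS = <<[seq v i | i <- s]>>%VS.
Proof.
elim: s => [|i s [J Js [fJ sJ]]].
  exists finset.set0; first by move=> i; rewrite inE.
  by rewrite enum_set0 /= nil_free.
have [vJ|vJ] := boolP (v i \in <<[seq v i | i <- s]>>%VS).
  exists J; first by move=> j /Js js; rewrite inE js orbT.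
  split=> //; rewrite /= span_cons sJ; apply/esym/addv_idPr.
  by rewrite -memvE.
have iJ : i \notin J by apply: contra vJ => iJ; rewrite -sJ memv_span // map_f ?mem_enum.
have pe : perm_eq [seq v j | j <- enum (i |: J)%SET] (v i :: [seq v j | j <- enum J]).
  rewrite -map_cons perm_map // uniq_perm ?enum_uniq //=.
    by rewrite mem_enum iJ enum_uniq.
  by move=> j; rewrite mem_enum !inE mem_enum.
exists (i |: J)%SET.
  by move=> j; rewrite !inE => /orP[->//|/Js ->]; rewrite orbT.
rewrite (perm_free pe) free_cons sJ vJ fJ; split=> //.
by rewrite (eq_span (perm_mem pe)) !span_cons /= sJ.
Qed.

Lemma free_card J : free [seq v i | i <- enum J] ->
  \dim <<[seq v i | i <- enum J]>> = #|J|.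
Proof. by move=> /eqP ->; rewrite size_map -cardE. Qed.

End FreeFamilies.

(** * The limit of |V_m| / m^s along A *)

Section Counting.
Variables (R : realType) (I : finType) (V : vectType rat) (v : I -> V).
Implicit Types (x y z : V) (c u : {ffun I -> nat}).
Hypothesis pointed : forall x, MM v x -> MM v (- x) -> x = 0.
Hypothesis SN : forall x, ZZ v x -> MM v (x *+ 2) -> MM v (x *+ 3) -> MM v x.

Let spanS := <<[seq v i | i <- enum (SI v)]>>%VS.
Let s := \dim spanS.

Lemma SS0 : SS v 0.
Proof. by have [m m1 Am] := exists_AA SN; exists m => //; apply: W0. Qed.

Lemma memS c : (forall i, (0 < c i)%N -> i \in SI v) -> ev v c \in spanS.
Proof.
move=> cS; apply/memv_suml => i _; have [->|ci] := posnP (c i).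
  by rewrite mulr0n mem0v.
by apply/rpredMn/memv_span/map_f; rewrite mem_enum cS.
Qed.

(** Supplies the shift [t] for the comparison of cubes: enough copies of a spanning set of
    generators absorb any fixed element of the face. *)
Lemma interior_shift (J : {set I}) u : J \subset SI v ->
  <<[seq v i | i <- enum J]>>%VS = spanS ->
  (forall i, (0 < u i)%N -> i \in SI v) ->
  exists t, MM v (\sum_i v i *~ ((i \in J)%:Z * t%:Z - (u i)%:Z)).
Proof.
move=> JS spJ uS; have [e e0 He] := torsion_exponent v J.
(* Adding every generator of the face to [u] creates a surplus: [e] times the vector in question has
   coefficients [b], positive on [SI v] and 0 elsewhere, so [MM_interior] applies. *)
pose u1 := [ffun i => (u i + (i \in SI v))%N].
have [a aJ ea] : exists2 a : I -> int, (forall i, i \notin J -> a i = 0)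
    & ev v u1 *+ e = \sum_i v i *~ a i.
  apply: He; first exact/MM_ZZ/MM_ev.
  rewrite spJ; apply: memS => i; rewrite ffunE; have [//|iS] := boolP (i \in SI v).
  by rewrite addn0 => /uS; rewrite (negbTE iS).
pose t := (\sum_i `|a i|)%N; exists t.
have at_ i : a i <= t%:Z.
  apply: le_trans (_ : `|a i|%N%:Z <= _); first by lia.
  by rewrite lez_nat /t (bigD1 i) //= leq_addr.
pose b i := (i \in J)%:Z * (t%:Z * e%:Z - a i) + (i \in SI v)%:Z * e%:Z.
have b0 i : 0 <= b i.
  rewrite /b addr_ge0 ?mulr_ge0 // subr_ge0; apply: le_trans (at_ i) _.
  by rewrite ler_peMr // lez_nat.
have bS i : i \in SI v -> 0 < b i.
  move=> iS; rewrite /b iS mul1r ltr_wpDl ?ltz_nat // mulr_ge0 // subr_ge0.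
  by apply: le_trans (at_ i) _; rewrite ler_peMr // lez_nat.
pose c := [ffun i => `|b i|%N].
apply: (MM_interior (k := e) (c := c) SN e0 erefl) => [|i].
  have -> : ev v c = \sum_i v i *~ b i.
    by rewrite ev_int; apply: eq_bigr => i _; rewrite ffunE gez0_abs.
  rewrite -[RHS](addrK (ev v u1 *+ e)) {1}ea ev_int -!sumrMnl -!big_split -sumrB /=.
  apply: eq_bigr => i _; rewrite !pmulrn -!mulrzA -mulrzDr -mulrzBr; congr (_ *~ _).
  rewrite /b !ffunE PoszD; have [iJ|/aJ ->] := boolP (i \in J).
    by rewrite /= !mul1r; ring.
  by rewrite /= !mul0r; ring.
rewrite ffunE => /eqP; rewrite absz_eq0 => /eqP bi.
have iS : i \notin SI v by apply/negP => /bS; rewrite bi ltxx.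
have iJ : i \notin J by apply: contra iS; exact: (fintype.subsetP JS).
rewrite (negbTE iJ) mul0r sub0r; apply/eqP; rewrite oppr_eq0.
by apply/eqP; congr Posz; apply/eqP; rewrite -leqn0 leqNgt; apply: contra iS => /uS.
Qed.

Section Representations.
Variables (L : set {ffun I -> nat}) (K : nat).
Hypothesis L_down : forall c d, L d -> (forall i, (c i <= d i)%N) -> L c.
Hypothesis L_inj : forall c d, L c -> L d -> ev v c = ev v d -> c = d.
Hypothesis L_onto : forall c, exists2 d, L d & ev v d = ev v c.
Hypothesis K_gt0 : (0 < K)%N.
Hypothesis L_trunc : forall c, L c <-> L (trunc K c).

(** If [m <= c i], then [ev v c - v i *+ m] is in M, so the condition of [W] puts [- v i] in M.
    Pointedness makes [v i] zero, and then its exponent is 0. *)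
Lemma W_lt m c : (0 < m)%N -> L c -> W v m (ev v c) -> forall i, (c i < m)%N.
Proof.
move=> m0 Lc [_ Wc] i; rewrite ltnNge; apply/negP => mc.
suff vi : v i = 0 by move: mc; rewrite (standard_zero L_down L_inj Lc vi) leqNgt m0.
apply: pointed; first exact: MMv.
apply: Wc; first exact/ZZN/MM_ZZ/MMv.
have [x Mx ->] := ev_pull v mc.
by rewrite addrA mulNrn addNr add0r.
Qed.

Definition piece_at m (u : {ffun I -> nat}) : set {ffun I -> nat} :=
  [set c | [/\ trunc K c = u, L c & W v m (ev v c)]].

Let top u := trunc_top K u.

(** The positive and negative parts of an integer relation on the free coordinates, each added to
    [u], still truncate to [u]; they are two representations in [L] of one element, hence equal. *)
Lemma top_free u : L u -> trunc K u = u -> free [seq v i | i <- enum (top u)].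
Proof.
move=> Lu tu; apply: free_intP => a aJ a0 i.
pose c (b : I -> int) := [ffun i => (u i + `|Num.max (b i) 0|)%N].
have Lc b : (forall i, i \notin top u -> b i = 0) -> L (c b).
  move=> bJ; apply/L_trunc; suff -> : trunc K (c b) = u by [].
  apply/ffunP => j; rewrite !ffunE; have [|jJ] := boolP (j \in top u).
    by rewrite inE => /eqP uj; rewrite uj; apply/minn_idPr/leq_addr.
  by rewrite bJ // maxxx addn0 -[in RHS]tu ffunE.
have /ffunP/(_ i) : c a = c (fun i => - a i).
  apply: L_inj; [exact: Lc| |].
    by apply: Lc => j /aJ ->; rewrite oppr0.
  apply/eqP; rewrite -subr_eq0 !ev_int -sumrB -[X in _ == X]a0; apply/eqP.
  apply: eq_bigr => j _; rewrite -mulrzBr; congr (_ *~ _).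
  by rewrite !ffunE; lia.
by rewrite !ffunE; lia.
Qed.

Lemma piece_almost_nondecreasing u :
  almost_nondecreasing (AA v) (fun m => (ncard (piece_at m u))%:R / m%:R ^+ s : R).
Proof.
have AA_gt0 m : AA v m -> (0 < m)%N by case.
have Elt m c : AA v m -> piece_at m u c -> forall i, (c i < m)%N.
  by move=> [m0 _] [_ Lc Wc]; apply: W_lt.
have Eoff m c : AA v m -> piece_at m u c -> forall i, i \notin top u -> c i = u i.
  by move=> _ [tc _ _]; apply: trunc_off.
(* Ratios of at most 1/m are absorbed by the term C/m; this settles empty pieces and pieces of
   smaller rank. *)
have small (a : nat -> R) : (forall m, AA v m -> 0 <= a m <= m%:R^-1) ->
    almost_nondecreasing (AA v) a.
  move=> ha; exists 1; split=> // m Am; have /andP[a0 a1] := ha m Am; split.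
    by rewrite a0 (le_trans a1) // invf_le1 ?ltr0n ?ler1n AA_gt0.
  move=> n An _; have /andP[an _] := ha n An.
  have : 0 <= m%:R / n%:R :> R by rewrite divr_ge0.
  by rewrite !mul1r; lra.
have [[m [c [Am Ec]]]|empty] :=
    pselect (exists m c, AA v m /\ piece_at m u c); last first.
  apply: small => m Am; have -> : piece_at m u = set0.
    by apply/seteqP; split=> // c Ec; case: empty; exists m, c.
  by rewrite /ncard fset_set0 cardfs0 mul0r lexx invr_ge0 ler0n.
have [tc Lc Wc] := Ec.
(* Exponents are below [m], so a positive one forces [m > 1]; then [ev v c] lies in the face, and
   with it every generator that occurs. *)
have cS i : (0 < c i)%N -> i \in SI v.
  move=> ci; have m1 : (1 < m)%N by apply: leq_ltn_trans (Elt m c Am Ec i).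
  have Sc : SS v (ev v c) by exists m.
  by have /(_ i ci) := (SS_ev c SS0).1 Sc.
have Lu : L u by rewrite -tc; apply: (L_trunc c).1.
have tu : trunc K u = u.
  by rewrite -tc; apply/ffunP => i; rewrite !ffunE -minnA minnn.
have cu i : (u i <= c i)%N by rewrite -tc ffunE geq_minl.
have uS i : (0 < u i)%N -> i \in SI v by move=> ui; apply: cS (leq_trans ui (cu i)).
have JS : top u \subset SI v.
  by apply/fintype.subsetP => j; rewrite inE => /eqP uj; apply: uS; rewrite uj.
have fJ := top_free Lu tu.
have spJ : (<<[seq v i | i <- enum (top u)]>> <= spanS)%VS.
  apply: sub_span => _ /mapP[i + ->]; rewrite mem_enum => /(fintype.subsetP JS) iS.
  by rewrite map_f // mem_enum.
(* Either there are fewer than [s] free coordinates and the piece is negligible, or the free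
   generators span the same space as the face. *)
have := dimvS spJ; rewrite (free_card fJ) -/s leq_eqVlt => /orP[/eqP Js|Js]; last first.
  apply: small => n An; have n0 : 0 < n%:R :> R by rewrite ltr0n AA_gt0.
  rewrite divr_ge0 ?exprn_ge0 //= ler_pdivrMr ?exprn_gt0 // mulrC.
  rewrite ler_pdivlMr // -natrM -natrX ler_nat.
  apply: leq_trans (_ : n ^ #|top u| * n <= _)%N.
    by rewrite leq_mul2r (E_card Elt Eoff) ?orbT.
  by rewrite -expnSr leq_pexp2l // AA_gt0.
have {}spJ : <<[seq v i | i <- enum (top u)]>>%VS = spanS.
  by apply/eqP; rewrite eqEdim spJ (free_card fJ) Js leqnn.
pose u0 : {ffun I -> nat} := [ffun i => if i \in top u then 0%N else u i].
have [t Mt] : exists t, MM v (\sum_i v i *~ ((i \in top u)%:Z * t%:Z - (u0 i)%:Z)).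
  by apply: interior_shift => // i; rewrite ffunE; case: ifP => // _ /uS.
rewrite -Js; apply: (E_almost_nondecreasing R AA_gt0 Elt Eoff (K := K) (t := t)).
move=> {m c Am Ec tc Lc Wc cS cu} m n c c' Am An [tc Lc Wc] c'off c'K mn.
have tc' : trunc K c' = u.
  apply/ffunP => i; rewrite ffunE; have [iJ|iJ] := boolP (i \in top u).
    by move: (iJ); rewrite inE => /eqP ->; apply/minn_idPr/c'K.
  by rewrite c'off // -[in RHS]tu ffunE.
split=> //; first by apply/L_trunc; rewrite tc'.
apply: (W_down Wc) => //; first exact: MM_ev.
pose b i := if i \in top u then (n * c i)%N%:Z - (m * (c' i + t))%N%:Z else (n * u i)%N%:Z.
have -> : ev v c *+ n - ev v c' *+ m = \sum_i v i *~ b i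
    + (\sum_i v i *~ ((i \in top u)%:Z * t%:Z - (u0 i)%:Z)) *+ m.
  rewrite !ev_int -!sumrMnl -sumrB -big_split; apply: eq_bigr => i _ /=.
  rewrite !pmulrn -!mulrzA -mulrzDr -mulrzBr; congr (_ *~ _).
  rewrite /b /u0 ffunE; have [iJ|iJ] := boolP (i \in top u).
    by rewrite /= !PoszM PoszD mul1r; ring.
  by rewrite c'off // (trunc_off tc iJ) /= !PoszM mul0r; ring.
apply: MMD; last exact: MMn.
apply: MM_int => i; rewrite /b; case: ifP => [iJ|_] //.
by rewrite subr_ge0 lez_nat mn.
Qed.

Lemma W_pieces m : (0 < m)%N ->
  finite_set [set y | W v m y] /\
  ncard [set y | W v m y] = (\sum_(u : {ffun I -> 'I_K.+1})
    ncard (piece_at m [ffun i => u i : nat]))%N.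
Proof.
move=> m0; pose C := [set c | L c /\ W v m (ev v c)].
have finC : finite_set C.
  apply: sub_finite_set (box_card (fun=> 0%N) (fun=> m)).1 => c [Lc Wc] i /=.
  by rewrite add0n (W_lt m0).
have WC : [set y | W v m y] = ev v @` C.
  apply/seteqP; split=> [y Wy|_ [c [_ Wc] <-] //].
  have [c yc] : MM v y by case: Wy.
  by have [d Ld dc] := L_onto c; exists d; rewrite /C /= dc -?yc.
rewrite WC; split; first exact: finite_image.
rewrite ncard_image //; last by move=> c d [Lc _] [Ld _]; apply: L_inj.
rewrite (ncard_trunc_partition K finC); apply: eq_bigr => u _; congr ncard.
by apply/seteqP; split=> c /= [] => [[Lc Wc] tc|tc Lc Wc].
Qed.

End Representations.

Lemma finite_W m : (0 < m)%N -> finite_set [set y | W v m y].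
Proof.
have [L [K [Ldown Linj Lonto K0 Ltrunc]]] := standard_representations v.
by move=> m0; have [] := W_pieces K Ldown Linj Lonto m0.
Qed.

(** The sum of a basis of [spanS] chosen among the generators lies in some W_k with k > 1. All
    combinations of the basis with exponents at most m / k then lie in W_m, and there are
    [(m %/ k).+1 ^ s] of them. *)
Lemma W_lower_bound : exists2 k, (0 < k)%N & forall m, AA v m ->
  (m ^ s <= k ^ s * ncard [set y | W v m y])%N.
Proof.
have [J JS [fJ sJ]] := free_subset v (enum (SI v)).
have cJ : #|J| = s by rewrite -(free_card fJ) sJ.
have {}JS i : i \in J -> i \in SI v by move/JS; rewrite mem_enum.
pose w : {ffun I -> nat} := [ffun i => (i \in J) : nat].
have [k k1 Wk] : SS v (ev v w).
  by apply: (SS_ev w SS0).2 => i; rewrite ffunE lt0b; apply: JS.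
exists k; first exact: ltnW.
move=> m Am; have [m0 _] := Am; set p := (m %/ k).+1.
have expn_mono a b e : (a <= b -> a ^ e <= b ^ e)%N.
  by case: e => // e ab; rewrite leq_exp2r.
have mkp : (m <= k * p)%N.
  by apply: ltnW; rewrite /p mulnC; apply: ltn_ceil; exact: ltnW.
apply: (@leq_trans (k ^ s * p ^ s)); first by rewrite -expnMn; apply: expn_mono.
rewrite leq_mul2l; apply/orP; right.
pose b i := if i \in J then p else 1%N.
have [finB cB] := box_card (fun=> 0%N) b.
have -> : (p ^ s = ncard (box (fun=> 0%N) b))%N.
  by rewrite cB -big_mkcond /= prod_nat_const cJ.
have cb c : box (fun=> 0%N) b c -> forall i, if i \in J then (c i * k <= m)%N else c i == 0%N.
  move=> cb i; have := cb i; rewrite /b add0n; case: ifP => _.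
    by rewrite ltnS => h; rewrite -leq_divRL // ltnW.
  by rewrite ltnS leqn0.
apply: (ncard_inj_le (f := ev v)); first exact: finite_W.
  move=> c /cb {}cb; apply: (W_down Wk) => //; first exact: MM_ev.
  rewrite !ev_int -!sumrMnl -sumrB.
  under eq_bigr do rewrite !pmulrn -!mulrzA -mulrzBr.
  apply: MM_int => i; rewrite ffunE; have := cb i; case: ifP => _.
    by move=> h; rewrite mul1r subr_ge0 -PoszM lez_nat.
  by move=> /eqP ->; rewrite !mul0r subrr.
move=> c d /cb bc /cb bd; apply: (free_ev_inj fJ) => i iJ.
by have := bc i; have := bd i; rewrite (negbTE iJ) => /eqP -> /eqP ->.
Qed.

Theorem W_limit : exists2 l : R, 0 < l &
  cvg_along (AA v) (fun m => (ncard [set y | W v m y])%:R / m%:R ^+ s) l.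
Proof.
have AA_gt0 m : AA v m -> (0 < m)%N by case.
have [L [K [Ldown Linj Lonto K0 Ltrunc]]] := standard_representations v.
have [l cl] : exists l : R,
    cvg_along (AA v) (fun m => (ncard [set y | W v m y])%:R / m%:R ^+ s) l.
  have := almost_nondecreasing_cvg AA_gt0 (ex_intro _ 1%N (AA1 v)) (almost_nondecreasing_sum
    (fun u : {ffun I -> 'I_K.+1} => piece_almost_nondecreasing Ldown Linj K0 Ltrunc [ffun i => u i : nat])).
  move=> [l cl]; exists l => e /cl[N HN]; exists N => n Nn An.
  have n0 := AA_gt0 n An.
  have [_ ->] := W_pieces K Ldown Linj Lonto n0.
  by rewrite natr_sum mulr_suml; apply: HN.
exists l => //.
have [k k0 Hk] := W_lower_bound.
have [m m1 Am] := exists_AA SN.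
(* Powers of one element above 1 are arbitrarily large members of A at which the lower bound k^-s
   meets the limit. *)
have AX N : AA v (m ^ N).
  by elim: N => [|N IH]; [exact: AA1|rewrite expnS; apply: AAM].
have ks0 : 0 < k%:R ^+ s :> R by rewrite exprn_gt0 // ltr0n.
rewrite ltNge; apply/negP => l0.
have [|N HN] := cl ((k%:R ^+ s)^-1 / 2); first by rewrite divr_gt0 // invr_gt0.
have /(_ (AX N)) := HN (m ^ N)%N (ltnW (ltn_expl N m1)).
have n0 : 0 < (m ^ N)%:R ^+ s :> R by rewrite exprn_gt0 // ltr0n expn_gt0 ltnW.
have : (k%:R ^+ s)^-1 <= (ncard [set y | W v (m ^ N) y])%:R / (m ^ N)%:R ^+ s :> R.
  rewrite ler_pdivlMr // ler_pdivrMl // -!natrX -natrM ler_nat.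
  exact: Hk.
have absurd (x y : R) : 0 < y -> y <= x -> `|x - l| <= y / 2 -> False.
  by clear -l0; rewrite ler_norml => y0 yx /andP[_]; lra.
by apply: absurd; rewrite invr_gt0.
Qed.

End Counting.

(** * Weyl's theorem and the face complementary to the pure prime *)

Section Weyl.
Variable q : nat.
Implicit Types (x g : 'rV[rat]_q) (h : 'cV[rat]_q).

Definition dot x h : rat := (x *m h) 0 0.

Lemma dotDl x y h : dot (x + y) h = dot x h + dot y h.
Proof. by rewrite /dot mulmxDl mxE. Qed.
Lemma dotNl x h : dot (- x) h = - dot x h.
Proof. by rewrite /dot mulNmx mxE. Qed.
Lemma dotBl x y h : dot (x - y) h = dot x h - dot y h.
Proof. by rewrite dotDl dotNl. Qed.
Lemma dotZl a x h : dot (a *: x) h = a * dot x h.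
Proof. by rewrite /dot -scalemxAl mxE. Qed.
Lemma dotMn x h k : dot (x *+ k) h = k%:R * dot x h.
Proof. by rewrite -scaler_nat dotZl. Qed.
Lemma dotMz x h k : dot (x *~ k) h = k%:~R * dot x h.
Proof. by rewrite -scaler_int dotZl. Qed.
Lemma dot0l h : dot 0 h = 0.
Proof. by rewrite /dot mul0mx mxE. Qed.
Lemma dot_suml (J : Type) (r : seq J) (F : J -> 'rV[rat]_q) h :
  dot (\sum_(j <- r) F j) h = \sum_(j <- r) dot (F j) h.
Proof. by rewrite /dot mulmx_suml summxE. Qed.
Lemma dotBr x h h' : dot x (h - h') = dot x h - dot x h'.
Proof. by rewrite /dot mulmxBr !mxE. Qed.
Lemma dotNr x h : dot x (- h) = - dot x h.
Proof. by rewrite /dot mulmxN mxE. Qed.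
Lemma dotZr a x h : dot x (a *: h) = a * dot x h.
Proof. by rewrite /dot -scalemxAr mxE. Qed.
Lemma dot_sumr (J : Type) (r : seq J) (F : J -> 'cV[rat]_q) x :
  dot x (\sum_(j <- r) F j) = \sum_(j <- r) dot x (F j).
Proof. by rewrite /dot mulmx_sumr summxE. Qed.
Lemma dot_delta x j : dot x (delta_mx j 0) = x 0 j.
Proof.
rewrite /dot mxE (bigD1 j) //= mxE !eqxx mulr1 big1 ?addr0 // => k /negbTE kj.
by rewrite mxE kj mulr0.
Qed.

(** The cone spanned by [s], with one coefficient quantified at a time so that elimination can
    proceed along the list. *)
Fixpoint incone (s : seq 'rV[rat]_q) x : Prop :=
  if s is g :: s' then exists2 t : rat, 0 <= t & incone s' (x - t *: g) else x = 0.

Lemma incone0 s : incone s 0.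
Proof. by elim: s => //= g s IH; exists 0; rewrite // scale0r subrr. Qed.

Lemma incone_mem s g : g \in s -> incone s g.
Proof.
elim: s => //= f s IH; rewrite inE => /orP[/eqP ->|/IH gs].
  by exists 1; rewrite // scale1r subrr; apply: incone0.
by exists 0; rewrite // scale0r subr0.
Qed.

(** Denominators of the coefficients are cleared one by one. [P] is left general since it will be M
    in one use and the differences of M and the face in another. *)
Lemma incone_multiple s x (P : 'rV[rat]_q -> Prop) :
  P 0 -> (forall y z, P y -> P z -> P (y + z)) -> (forall g, g \in s -> P g) ->
  incone s x -> exists2 k, (0 < k)%N & P (x *+ k).
Proof.
move=> P0 PD; have PM y k : P y -> P (y *+ k).
  by move=> Py; elim: k => // k IH; rewrite mulrS; apply: PD.
elim: s x => /= [x _ ->|g s IH x Ps [t t0 /IH[f fs|k k0 Pk]]].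
- by exists 1%N.
- by apply: Ps; rewrite inE fs orbT.
have d0 : (0 < `|denq t|)%N by rewrite absz_gt0 denq_neq0.
exists (k * `|denq t|)%N; first by rewrite muln_gt0 k0.
have -> : x *+ (k * `|denq t|) = (x - t *: g) *+ k *+ `|denq t| + g *+ (k * `|numq t|).
  rewrite -mulrnA mulrnBl -addrA -[LHS]addr0; congr (_ + _).
  apply/esym/eqP; rewrite addrC subr_eq0; apply/eqP.
  rewrite -!scaler_nat scalerA; congr (_ *: _).
  rewrite !natrM -mulrA; congr (_ * _).
  have -> : (`|numq t|%N)%:R = (numq t)%:~R :> rat.
    by rewrite pmulrn gez0_abs // numq_ge0.
  by rewrite numqE mulrC pmulrn absz_denq.
apply: PD; first exact: PM.
by apply/PM/Ps; rewrite inE eqxx.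
Qed.

Lemma seq_max0 (r : seq rat) : exists t, [/\ 0 <= t,
  forall y, y \in r -> y <= t & t = 0 \/ t \in r].
Proof.
elim: r => [|y r [t [t0 tr tE]]]; first by exists 0; split=> //; left.
have [yt|ty] := lerP y t.
  exists t; split=> // [z|]; first by rewrite inE => /orP[/eqP ->|/tr].
  by case: tE => [->|tin]; [left|right; rewrite inE tin orbT].
exists y; split; first exact: le_trans (ltW ty).
  move=> z; rewrite inE => /orP[/eqP ->//|/tr zt]; exact: le_trans (ltW ty).
by right; rewrite inE eqxx.
Qed.

(* Weyl's theorem, by Fourier-Motzkin elimination of one coefficient at a time. *)
Lemma incone_halfspaces s : exists H : seq 'cV[rat]_q,
  forall x, incone s x <-> forall h, h \in H -> 0 <= dot x h.
Proof.
elim: s => [|g s [H IH]].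
  exists ([seq delta_mx j 0 | j : 'I_q] ++ [seq - delta_mx j 0 | j : 'I_q]) => x.
  split=> [->|hx] /=; first by move=> h _; rewrite dot0l.
  apply/rowP => j; rewrite mxE; apply/eqP; rewrite eq_le; apply/andP; split.
    rewrite -oppr_ge0 -dot_delta -dotNr; apply: hx.
    by rewrite mem_cat; apply/orP; right; apply/mapP; exists j; rewrite ?mem_enum.
  rewrite -dot_delta; apply: hx.
  by rewrite mem_cat; apply/orP; left; apply/mapP; exists j; rewrite ?mem_enum.
pose HN := [seq h <- H | dot g h < 0]; pose HP := [seq h <- H | 0 < dot g h].
(* Each functional negative on [g] is paired with each positive one to a combination that vanishes
   on [g]. *)
exists ([seq h <- H | 0 <= dot g h] ++ [seq dot g p *: n - dot g n *: p | n <- HN, p <- HP]).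
move=> x; split=> [[t t0 /IH hx] h|hx].
  rewrite mem_cat => /orP[|/allpairsP[[n p] /= [nN pP ->]]].
    rewrite mem_filter => /andP[gh hH].
    by have := hx h hH; rewrite dotBl dotZl subr_ge0; apply: le_trans; rewrite mulr_ge0.
  move: nN pP; rewrite !mem_filter => /andP[gn nH] /andP[gp pH].
  have := hx n nH; have := hx p pH; rewrite !dotBl !dotZl dotBr !dotZr !subr_ge0 => hp hn.
  have h1 := ler_wpM2l (ltW gp) hn.
  have h2 := ler_wnM2l (ltW gn) hp.
  by apply: le_trans h2 _; apply: le_trans h1; rewrite mulrCA [leRHS]mulrCA (mulrC (dot g n)).
(* Functionals negative on [g] bound the coefficient from below; [t] is the largest of these bounds
   and 0. *)
have [t [t0 tmax tE]] := seq_max0 [seq dot x n / dot g n | n <- HN].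
exists t => //; apply/IH => h hH; rewrite dotBl dotZl subr_ge0.
have [gh|gh|gh] := ltgtP (dot g h) 0; last by rewrite gh mulr0; apply: hx; rewrite
    mem_cat mem_filter gh lexx hH.
  rewrite -ler_ndivrMr //; apply: tmax; apply/mapP; exists h => //.
  by rewrite mem_filter gh.
case: tE => [->|/mapP[n nN ->]].
  by rewrite mul0r; apply: hx; rewrite mem_cat mem_filter (ltW gh) hH.
have hnh : 0 <= dot x (dot g h *: n - dot g n *: h).
  apply: hx; rewrite mem_cat; apply/orP; right; apply/allpairsP; exists (n, h).
  by split=> //=; rewrite mem_filter gh.
move: nN; rewrite mem_filter => /andP[gn nH].
rewrite dotBr !dotZr subr_ge0 in hnh.
by rewrite mulrAC ler_ndivrMr // mulrC [leRHS]mulrC.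
Qed.

(** Weyl's theorem is applied to the cone on all generators and the negatives of those in the face,
    and its functionals are summed. If the sum vanishes on [v i], then [- v i] is in the cone, so
    some multiple of [v i] is a summand of an element of the face. *)
Lemma supporting_functional (I : finType) (v : I -> 'rV[rat]_q) : SS v 0 ->
  exists l : 'cV[rat]_q, forall i, 0 <= dot (v i) l /\
    (dot (v i) l == 0) = (i \in SI v).
Proof.
move=> S0; pose s := [seq v i | i : I] ++ [seq - v i | i <- enum (SI v)].
have [H HH] := incone_halfspaces s.
have vs i : v i \in s by rewrite mem_cat map_f // mem_enum.
have Hv i h : h \in H -> 0 <= dot (v i) h.
  by move=> hH; apply: (HH (v i)).1 => //; apply: incone_mem.
exists (\sum_(h <- H) h) => i; rewrite dot_sumr.
have sum0 : 0 <= \sum_(h <- H) dot (v i) h.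
  by rewrite big_seq; apply: sumr_ge0 => h; apply: Hv.
split=> //; apply/eqP/idP => [l0|iS]; last first.
  apply/eqP; rewrite eq_le sum0 andbT big_seq; apply: sumr_le0 => h hH.
  rewrite -oppr_ge0 -dotNl; apply: (HH (- v i)).1 => //; apply: incone_mem.
  by rewrite mem_cat; apply/orP; right; apply/mapP; exists i; rewrite ?mem_enum.
have h0 h : h \in H -> dot (v i) h = 0.
  move=> hH; apply/eqP; rewrite eq_le Hv // andbT -l0 (big_rem h) //= lerDl.
  by rewrite big_seq; apply: sumr_ge0 => h' /mem_rem; apply: Hv.
have: incone s (- v i) by apply/HH => h hH; rewrite dotNl h0 ?oppr0.
pose P x := exists a b, [/\ MM v a, SS v b & x = a - b].
case/(@incone_multiple _ _ P).
- by exists 0, 0; split=> //; [exact: MM0|rewrite subr0].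
- move=> _ _ [a [b [Ma Sb ->]]] [c [d [Mc Sd ->]]].
  by exists (a + c), (b + d); split; [exact: MMD|exact: SSD|rewrite opprD addrACA].
- move=> g; rewrite mem_cat => /orP[/mapP[j _ ->]|/mapP[j + ->]].
    by exists (v j), 0; split; [exact: MMv| |rewrite subr0].
  rewrite mem_enum => /SIP Sj.
  by exists 0, (v j); split; [exact: MM0| |rewrite sub0r].
move=> k k0 [a [b [Ma Sb]]] /eqP; rewrite mulNrn eq_sym subr_eq addrC => /eqP aE.
apply/SIP/(@SSn_inv _ _ _ _ k) => //; first exact: MMv.
apply: (@SS_down _ _ _ _ a) => //; last exact/MMn/MMv.
by rewrite aE addrCA subrr addr0.
Qed.

End Weyl.

(** * Sequences of polynomial growth *)

Section PolynomialGrowth.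
Variable R : realType.
Implicit Types (a b : nat -> R) (c : R).

Lemma cvg_invn : (n%:R^-1 : R) @[n --> \oo] --> (0 : R).
Proof. by rewrite -(cvg_shiftn 1); under eq_fun do rewrite addn1; exact: cvg_harmonic. Qed.

Lemma cvg_exprn a c d : a n @[n --> \oo] --> c -> (a n ^+ d) @[n --> \oo] --> c ^+ d.
Proof.
move=> ac; elim: d => [|d IH].
  by rewrite expr0; under eq_fun do rewrite expr0; exact: cvg_cst.
by rewrite exprS; under eq_fun do rewrite exprS; exact: cvgM.
Qed.

Lemma cvg_ratio_shift k : ((n - k)%N%:R / n%:R : R) @[n --> \oo] --> (1 : R).
Proof.
have h : (1 - k%:R * n%:R^-1 : R) @[n --> \oo] --> (1 : R).
  rewrite -[X in _ --> X](subr0 1) -[X in _ - X](mulr0 k%:R).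
  by apply: cvgB; [exact: cvg_cst|apply: cvgM; [exact: cvg_cst|exact: cvg_invn]].
apply: cvg_trans h; apply: near_eq_cvg; near=> n.
have kn : (k < n)%N by near: n; exact: nbhs_infty_gt.
rewrite natrB ?(ltnW kn) // mulrBl divff // pnatr_eq0 -lt0n.
exact: leq_ltn_trans kn.
Unshelve. all: end_near. Qed.

Lemma growth_degree_lt a c d e : (d < e)%N ->
  (a n / n%:R ^+ d) @[n --> \oo] --> c -> (a n / n%:R ^+ e) @[n --> \oo] --> (0 : R).
Proof.
move=> de ac.
have : (a n / n%:R ^+ d * n%:R^-1 ^+ (e - d)) @[n --> \oo] --> c * 0 ^+ (e - d).
  by apply: cvgM => //; apply: cvg_exprn; exact: cvg_invn.
rewrite expr0n subn_eq0 leqNgt de /= mulr0.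
under eq_fun => n do rewrite exprVn -mulrA -invfM -exprD subnKC ?(ltnW de) //.
by [].
Qed.

Lemma growth_shift a c d k : (a n / n%:R ^+ d) @[n --> \oo] --> c ->
  (a (n - k)%N / n%:R ^+ d) @[n --> \oo] --> c.
Proof.
move=> ac; have h : (a (n - k)%N / (n - k)%N%:R ^+ d * ((n - k)%N%:R / n%:R) ^+ d)
    @[n --> \oo] --> c * 1 ^+ d.
  apply: cvgM; first by rewrite (cvg_centern k (fun n => a n / n%:R ^+ d)).
  exact/cvg_exprn/cvg_ratio_shift.
rewrite expr1n mulr1 in h; apply: cvg_trans h; apply: near_eq_cvg; near=> n.
have kn : (k < n)%N by near: n; exact: nbhs_infty_gt.
by rewrite expr_div_n mulrA divfK // expf_neq0 // pnatr_eq0 subn_eq0 -ltnNge.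
Unshelve. all: end_near. Qed.

(** Discrete integration with step [w]: after removal of the expected main term the increments are
    o(n^d), and they add up to o(n^(d+1)). *)
Lemma growth_integral a b c d w : (0 < w)%N ->
  (forall n, b (n + w)%N = b n + a (n + w)%N) ->
  (a n / n%:R ^+ d) @[n --> \oo] --> c ->
  (b n / n%:R ^+ d.+1) @[n --> \oo] --> c / (w * d.+1)%:R.
Proof.
move=> w0 ba ac; set g := c / _.
have w0' : w%:R != 0 :> R by rewrite pnatr_eq0 -lt0n.
pose f n := b n - g * n%:R ^+ d.+1.
(* For y = (n - w) / n, this sum is the cofactor of y - 1 in y^k - 1; it gives the increment of the
   main term. *)
have geo k : (\sum_(i < k) ((n - w)%N%:R / n%:R) ^+ i : R) @[n --> \oo] --> (k%:R : R).
  elim: k => [|k IH]; first by under eq_fun do rewrite big_ord0; exact: cvg_cst.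
  under eq_fun do rewrite big_ord_recr /=.
  rewrite -natr1; apply: cvgD => //; rewrite -[X in _ --> X](expr1n _ k).
  exact/cvg_exprn/cvg_ratio_shift.
have fa : ((f n - f (n - w)%N) / n%:R ^+ d) @[n --> \oo] --> (0 : R).
  have h : (a n / n%:R ^+ d - g * w%:R * \sum_(i < d.+1) ((n - w)%N%:R / n%:R) ^+ i)
      @[n --> \oo] --> c - g * w%:R * d.+1%:R.
    by apply: cvgB => //; apply: cvgM => //; exact: cvg_cst.
  have g0 : c - g * w%:R * d.+1%:R = 0.
    by rewrite /g natrM -mulrA divfK ?subrr // mulf_neq0 // pnatr_eq0.
  rewrite g0 in h; apply: cvg_trans h; apply: near_eq_cvg; near=> n.
  have wn : (w < n)%N by near: n; exact: nbhs_infty_gt.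
  have n0 : n%:R != 0 :> R by rewrite pnatr_eq0 -lt0n (leq_ltn_trans _ wn).
  have nd0 : n%:R ^+ d != 0 :> R by rewrite expf_neq0.
  have := ba (n - w)%N; rewrite subnK ?(ltnW wn) // => bn.
  rewrite /f bn.
  set y := (n - w)%N%:R / n%:R.
  have yn : (n - w)%N%:R = y * n%:R :> R by rewrite divfK.
  have yw : w%:R = (1 - y) * n%:R :> R.
    by rewrite mulrBl mul1r -yn natrB ?(ltnW wn) // opprB addrC subrK.
  rewrite yn yw [(y * n%:R) ^+ _]exprMn.
  have := subrX1 y d.+1; set S := \sum_(i < _) _ => yS.
  rewrite [n%:R ^+ d.+1]exprS.
  have -> : b (n - w)%N + a n - g * (n%:R * n%:R ^+ d) -
      (b (n - w)%N - g * (y ^+ d.+1 * (n%:R * n%:R ^+ d)))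
    = a n + (y ^+ d.+1 - 1) * (g * n%:R) * n%:R ^+ d by ring.
  by rewrite yS [RHS]mulrDl [X in _ = _ + X]mulfK //; congr (_ + _); ring.
have : (f n / n%:R ^+ d.+1) @[n --> \oo] --> (0 : R).
  apply/cvgrPdist_le => e e0; have e20 : 0 < e / 2 by rewrite divr_gt0.
  move/cvgrPdist_le : fa => /(_ _ e20)[m0 _ Hm0].
  pose m := maxn m0 w.+1.
  have Hm n : (m <= n)%N -> `|f n - f (n - w)%N| <= e / 2 * n%:R ^+ d.
    move=> mn; have n0 : (0 < n)%N.
      by apply: leq_trans mn; rewrite /m (leq_trans _ (leq_maxr _ _)).
    have /= := Hm0 n (leq_trans (leq_maxl _ _) mn).
    rewrite sub0r normrN normrM normfV [X in _ / X]ger0_norm ?exprn_ge0 //.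
    by rewrite ler_pdivrMr // exprn_gt0 // ltr0n.
  pose C := \sum_(i < m) `|f i|.
  have C0 : 0 <= C by apply: sumr_ge0.
  (* Below [m] the value is a summand of [C]; beyond, the induction descends by [w], and (n -
     w)^(d+1) + n^d <= n^(d+1) absorbs the increment. *)
  have Cf n : `|f n| <= C + e / 2 * n%:R ^+ d.+1.
    have [k] := ubnP n; elim: k n => // k IH n nk.
    have [mn|nm] := leqP m n; last first.
      apply: le_trans (_ : C <= _); last by rewrite lerDl mulr_ge0 ?(ltW e20) // exprn_ge0.
      by rewrite /C (bigD1 (Ordinal nm)) //= lerDl sumr_ge0.
    have wn : (w < n)%N by apply: leq_trans mn; rewrite leq_maxr.
    have h1 := Hm n mn.
    have h2 : `|f (n - w)%N| <= C + e / 2 * (n - w)%N%:R ^+ d.+1 by apply: IH; lia.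
    have h3 : (n - w)%N%:R ^+ d.+1 + n%:R ^+ d <= n%:R ^+ d.+1 :> R.
      rewrite -!natrX -natrD ler_nat !expnS.
      apply: leq_trans (_ : (n - w) * n ^ d + n ^ d <= _)%N.
        rewrite leq_add2r leq_mul2l; apply/orP; right.
        by case: (d) => // d'; rewrite leq_exp2r // leq_subr.
      by rewrite -mulSnr leq_mul2r; apply/orP; right; lia.
    have h4 := ler_wpM2l (ltW e20) h3; rewrite mulrDr in h4.
    have := ler_normD (f n - f (n - w)%N) (f (n - w)%N); rewrite subrK => h5.
    apply: le_trans h5 _; apply: le_trans (lerD h1 h2) _.
    by rewrite addrCA lerD2l addrC.
  have [N HN] := nat_large (C / (e / 2)).
  exists (maxn N 1) => // n /= Nn; rewrite sub0r normrN normrM normfV.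
  have n0 : (0 < n)%N by apply: leq_trans Nn; rewrite leq_maxr.
  have nd : 0 < n%:R ^+ d.+1 :> R by rewrite exprn_gt0 // ltr0n.
  rewrite [X in _ / X]gtr0_norm // ler_pdivrMr //; apply: le_trans (Cf n) _.
  rewrite [X in _ <= X * _](splitr e) mulrDl lerD2r.
  have := HN n (leq_trans (leq_maxl _ _) Nn); rewrite ler_pdivrMr // => /le_trans; apply.
  rewrite mulrC ler_pM2l // exprS ler_peMr // -natrX ler1n expn_gt0 n0 //.
move=> h; have : (f n / n%:R ^+ d.+1 + g) @[n --> \oo] --> 0 + g.
  by apply: cvgD => //; exact: cvg_cst.
rewrite add0r; apply: cvg_trans; apply: near_eq_cvg; near=> n.
have n0 : n%:R ^+ d.+1 != 0 :> R.
  by rewrite expf_neq0 // pnatr_eq0 -lt0n; near: n; exact: nbhs_infty_gt.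
by rewrite /f mulrBl mulfK // subrK.
Unshelve. all: end_near. Qed.

(* Sequences equivalent to a positive rational multiple of a power of n; the
   zero sequence is allowed so that sums stay in the class. *)
Definition rational_growth a := (forall n, a n = 0) \/
  exists d (c : rat), 0 < c /\ (a n / n%:R ^+ d) @[n --> \oo] --> (ratr c : R).

Lemma rational_growthD a b : rational_growth a -> rational_growth b ->
  rational_growth (fun n => a n + b n).
Proof.
move=> [a0|[d [c [c0 ac]]]].
  suff -> : (fun n => a n + b n) = b by [].
  by apply/funext => n; rewrite a0 add0r.
move=> [b0|[e [c' [c'0 bc]]]].
  right; exists d, c; split=> //.
  by under eq_fun do rewrite b0 addr0.
right; have [de|ed|de] := ltngtP d e.
- exists e, c'; split=> //; under eq_fun do rewrite mulrDl.
  by rewrite -(add0r (ratr c')); apply: cvgD => //; exact: growth_degree_lt ac.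
- exists d, c; split=> //; under eq_fun do rewrite mulrDl.
  by rewrite -(addr0 (ratr c)); apply: cvgD => //; exact: growth_degree_lt bc.
- rewrite -de in bc; exists d, (c + c'); split; first exact: addr_gt0.
  by under eq_fun do rewrite mulrDl; rewrite rmorphD; apply: cvgD.
Qed.

Lemma rational_growth_sum (J : finType) (a : J -> nat -> R) :
  (forall j, rational_growth (a j)) -> rational_growth (fun n => \sum_j a j n).
Proof.
move=> Ha; have -> : (fun n => \sum_j a j n) = \sum_j a j.
  by apply/funext => n; rewrite fct_sumE.
elim/big_ind: _ => [|b b'|//]; first by left.
exact: rational_growthD.
Qed.

(** With different exponents one of two positive limits would be 0. *)
Lemma rational_growth_lim a d c : rational_growth a -> 0 < c ->
  (a n / n%:R ^+ d) @[n --> \oo] --> c -> exists r : rat, c = ratr r.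
Proof.
move=> [a0|[e [r [r0 ar]]]] c0 ac.
  have a0' : (a n / n%:R ^+ d) @[n --> \oo] --> (0 : R).
    by under eq_fun do rewrite a0 mul0r; exact: cvg_cst.
  by have := cvg_unique (@Rhausdorff R) ac a0' => c0'; move: c0; rewrite c0' ltxx.
have [de|ed|de] := ltngtP d e.
- have h : ratr r = 0 :> R := cvg_unique (@Rhausdorff R) ar (growth_degree_lt de ac).
  by move: r0; rewrite -(ltr0q R) h ltxx.
- have h := cvg_unique (@Rhausdorff R) ac (growth_degree_lt ed ar).
  by move: c0; rewrite h ltxx.
- by rewrite de in ac; exists r; apply: (cvg_unique (@Rhausdorff R) ac ar).
Qed.

End PolynomialGrowth.

(** * Lattice points of growing simplices *)

Section SimplexCount.
Variables (R : realType) (I : finType) (w : I -> nat).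
Implicit Types (r : seq I) (c : {ffun I -> nat}).

Definition simplex r (X : nat) : set {ffun I -> nat} :=
  [set c | (forall i, i \notin r -> c i = 0%N) /\ (\sum_i c i * w i < X)%N].

Lemma finite_simplex r X : (forall i, i \in r -> (0 < w i)%N) ->
  finite_set (simplex r X).
Proof.
move=> w0; apply: sub_finite_set (box_card (fun=> 0%N) (fun=> X)).1.
move=> c [cr cX] i; rewrite /= add0n; apply: leq_ltn_trans cX.
have [ir|/cr -> //] := boolP (i \in r).
rewrite (bigD1 i) //=; apply: leq_trans (leq_addr _ _).
by rewrite leq_pmulr // w0.
Qed.

(** Points with [c j > 0] correspond to the simplex of size [X] by lowering [c j] by one; the others
    form a simplex on [r]. *)
Lemma simplex_rec j r X : j \notin r -> (forall i, i \in j :: r -> (0 < w i)%N) ->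
  ncard (simplex (j :: r) (X + w j)) =
    (ncard (simplex (j :: r) X) + ncard (simplex r (X + w j)))%N.
Proof.
move=> jr w0; have fin X' := finite_simplex X' w0.
rewrite (ncard_partition (fun c => c j == 0%N)) // big_bool [LHS]addnC; congr (_ + _)%N.
  pose f c : {ffun I -> nat} := [ffun i => (c i + (i == j))%N].
  have fw c : (\sum_i f c i * w i = \sum_i c i * w i + w j)%N.
    have -> : (w j = \sum_i (i == j) * w i)%N.
      by rewrite (bigD1 j) //= eqxx mul1n big1 ?addn0 // => i /negbTE ->.
    by rewrite -big_split; apply: eq_bigr => i _; rewrite ffunE mulnDl.
  rewrite -(ncard_image (f := f) (fin X)); last first.
    move=> c d _ _ /ffunP cd; apply/ffunP => i.
    by have := cd i; rewrite !ffunE => /addIn.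
  congr ncard; apply/seteqP; split=> c /=.
    move=> [[cr cX] cj].
    have cf : c = f [ffun i => (c i - (i == j))%N].
      apply/ffunP => i; rewrite !ffunE; case: eqP => [->|_] /=.
        by rewrite subnK // lt0n (negbT cj).
      by rewrite subn0 addn0.
    exists [ffun i => (c i - (i == j))%N] => //; split.
      by move=> i /cr ci; rewrite ffunE ci.
    by move: cX; rewrite {1}cf fw ltn_add2r.
  move=> [d [dr dX] <-]; split; last by rewrite ffunE eqxx addn1.
  split; last by rewrite fw ltn_add2r.
  move=> i ir; rewrite ffunE dr //; move: ir; rewrite inE negb_or.
  by case/andP => /negbTE ->.
congr ncard; apply/seteqP; split=> c /=.
  move=> [[cr cX] /eqP cj]; split=> // i ir.
  by have [->//|ij] := eqVneq i j; apply: cr; rewrite inE negb_or ij.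
move=> [cr cX]; split; last by rewrite cr.
by split=> // i; rewrite inE negb_or => /andP[_]; apply: cr.
Qed.

(** The constant obtained is the volume of the simplex: 1 over [(size r)!] times the product of the
    weights. *)
Lemma simplex_growth r : uniq r -> (forall i, i \in r -> (0 < w i)%N) ->
  exists2 c : rat, 0 < c & ((ncard (simplex r n))%:R / n%:R ^+ size r : R)
    @[n --> \oo] --> (ratr c : R).
Proof.
elim: r => [_ _|j r IH /= /andP[jr ur] w0].
  exists 1 => //; rewrite rmorph1.
  have h : (1 : R) @[n --> \oo] --> (1 : R) by exact: cvg_cst.
  apply: cvg_trans h; apply: near_eq_cvg; near=> n.
  have -> : simplex [::] n = [set [ffun=> 0%N]].
    apply/seteqP; split=> [c [c0 _]|_ ->].
      by apply/ffunP => i; rewrite ffunE c0.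
    split=> [i _|]; first by rewrite ffunE.
    rewrite big1 => [|i _]; last by rewrite ffunE.
    by near: n; exact: nbhs_infty_gt.
  by rewrite /ncard fset_set1 cardfs1 expr0 divr1.
have wj : (0 < w j)%N by apply: w0; rewrite inE eqxx.
have [|c c0 cr] := IH ur.
  by move=> i ir; apply: w0; rewrite inE ir orbT.
exists (c / (w j * (size r).+1)%:R).
  by rewrite divr_gt0 // ltr0n muln_gt0 wj.
rewrite fmorph_div rmorph_nat.
apply: (growth_integral (a := fun n => (ncard (simplex r n))%:R) wj) => // n.
by rewrite -natrD -simplex_rec.
Unshelve. all: end_near. Qed.

End SimplexCount.

(** Dickson's lemma pulled back along the functions [f o]: bounded patterns index the family, and
    those not attained get the default [x0]. *)
Lemma dickson_representatives (C : finType) (X : Type) (f : C -> X -> nat)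
    (P : X -> Prop) (x0 : X) :
  exists (J : finType) (b : J -> X), (forall j, P (b j) \/ b j = x0) /\
    forall p, P p -> exists j, P (b j) /\ forall o, (f o (b j) <= f o p)%N.
Proof.
pose F p : {ffun C -> nat} := [ffun o => f o p].
have [K HK] := dickson [set c | exists2 p, P p & F p = c].
pose Q (j : {ffun C -> 'I_K.+1}) p := P p /\ F p = [ffun o => j o : nat].
have /choice[b Hb] : forall j, exists p,
    (exists p, Q j p) /\ Q j p \/ ~ (exists p, Q j p) /\ p = x0.
  move=> j; have [[p Qp]|nQ] := pselect (exists p, Q j p).
    by exists p; left; split=> //; exists p.
  by exists x0; right.
exists {ffun C -> 'I_K.+1}, b; split=> [j|p Pp].
  by have [[_ []]|[_ ->]] := Hb j; [left|right].
have [_ [[p' Pp' <-] p'p p'K]] := HK (F p) (ex_intro2 _ _ p Pp erefl).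
pose j : {ffun C -> 'I_K.+1} := [ffun o => inord (F p' o)].
have Qj : Q j p'.
  by split=> //; apply/ffunP => o; rewrite !ffunE inordK // ltnS; have := p'K o; rewrite ffunE.
have [[_ [Pb Fb]]|[[]]] := Hb j; last by exists p'.
exists j; split=> // o; have := p'p o.
have -> : F p' = F (b j) by rewrite Fb; case: Qj.
by rewrite !ffunE.
Qed.

(** * Normal monoids: facets, Gordan's lemma and rationality of the limit *)

Section Normal.
Variables (R : realType) (I : finType) (q : nat) (v : I -> 'rV[rat]_q).
Implicit Types (x y z : 'rV[rat]_q) (h : 'cV[rat]_q).
Hypothesis pointed : forall x, MM v x -> MM v (- x) -> x = 0.
Hypothesis NV : forall x k, ZZ v x -> (0 < k)%N -> MM v (x *+ k) -> MM v x.

Lemma normal_AA m : (0 < m)%N -> AA v m.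
Proof. by move=> m0; split=> // x Zx; apply: NV. Qed.

(** After clearing denominators the values on ZM form a nonzero group of integers, generated by its
    least positive element through division with remainder. *)
Lemma ZZ_dot_lattice h : (exists2 x, ZZ v x & dot x h != 0) ->
  exists d, [/\ 0 < d, exists2 x, ZZ v x & dot x h = d
    & forall x, ZZ v x -> exists z : int, dot x h = z%:~R * d].
Proof.
move=> [x1 Zx1 x1h]; have [e e0 He] := common_denominator (fun i => dot (v i) h).
have [b Hb] := choice He.
have e0' : e%:R != 0 :> rat by rewrite pnatr_eq0 -lt0n.
have eZ x : ZZ v x -> exists z : int, e%:R * dot x h = z%:~R.
  move=> /ZZ_int[a ->]; exists (\sum_i a i * b i); rewrite dot_suml mulr_sumr rmorph_sum.
  by apply: eq_bigr => i _; rewrite dotMz mulrCA Hb rmorphM.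
have exn : exists n, `[< (0 < n)%N /\ exists2 x, ZZ v x & e%:R * dot x h = n%:R >].
  have [z Hz] := eZ x1 Zx1; exists `|z|%N; apply/asboolP; split.
    rewrite absz_gt0; apply/eqP => z0; move/eqP: Hz.
    by rewrite z0 mulf_eq0 (negbTE e0') (negbTE x1h).
  case: z Hz => n Hz; first by exists x1.
  exists (- x1); first exact: ZZN.
  by rewrite dotNl mulrN Hz NegzE mulrNz opprK.
case: (ex_minnP exn) => n /asboolP[n0 [x0 Zx0 x0n]] nmin.
have n0' : 0 < n%:R :> rat by rewrite ltr0n.
have x0E : dot x0 h = n%:R / e%:R by rewrite -x0n mulrC mulKf.
exists (n%:R / e%:R); split.
- by rewrite divr_gt0 // ltr0n.
- by exists x0.
move=> x Zx; have [z Hz] := eZ x Zx; exists (z %/ n)%Z.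
pose y := x - x0 *~ (z %/ n)%Z.
have Zy : ZZ v y by apply: ZZB => //; exact: ZZz.
have yE : e%:R * dot y h = (z %% n)%Z%:~R.
  rewrite dotBl dotMz mulrBr Hz mulrCA x0n {1}(divz_eq z n) intrD intrM.
  by rewrite -[n%:~R]/(n%:R) addrAC subrr add0r.
have n1 : n%:Z != 0 by rewrite eqz_nat -lt0n.
have := modz_ge0 z n1; case zn : (z %% n)%Z => [r|//] _.
have r0 : r = 0%N.
  apply/eqP; rewrite -leqn0 leqNgt; apply/negP => r0.
  have : (n <= r)%N by apply: nmin; apply/asboolP; split=> //; exists y; rewrite // yE zn.
  by rewrite leqNgt -ltz_nat -zn ltz_pmod.
have /eqP : e%:R * dot y h = 0 by rewrite yE zn r0.
rewrite mulf_eq0 (negbTE e0') /= dotBl dotMz subr_eq0 => /eqP ->.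
by rewrite x0E.
Qed.

(** The last clause sharpens irredundancy: a lattice point violates [h] alone, and by exactly 1. It
    yields the upper bound in [W_normal]. *)
Definition facets (H : seq 'cV[rat]_q) := [/\
  forall x, ZZ v x -> (MM v x <-> forall h, h \in H -> 0 <= dot x h),
  forall h x, h \in H -> ZZ v x -> exists z : int, dot x h = z%:~R
  & forall h, h \in H -> exists y, [/\ ZZ v y, dot y h = -1
      & forall h', h' \in H -> h' != h -> 0 <= dot y h']].

(* A half-space description of the cone with as few functionals as possible,
   each scaled to take exactly the integers as values on ZM. *)
Lemma exists_facets : exists H, facets H.
Proof.
pose spec (H : seq 'cV[rat]_q) :=
  forall x, ZZ v x -> (MM v x <-> forall h, h \in H -> 0 <= dot x h).
have exH : exists n, `[< exists2 H, spec H & size H = n >].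
  have [H HH] := incone_halfspaces [seq v i | i : I].
  exists (size H); apply/asboolP; exists H => // x Zx; split=> [[c ->] h hH|hx].
    rewrite dot_suml; apply: sumr_ge0 => i _; rewrite dotMn mulr_ge0 //.
    by apply: (HH (v i)).1 => //; apply: incone_mem; rewrite map_f ?mem_enum.
  have [|y z My Mz|g /mapP[i _ ->]|k k0 Mk] := @incone_multiple _ _ _ (MM v) _ _ _ ((HH x).2 hx).
  - exact: MM0.
  - exact: MMD.
  - exact: MMv.
  - exact: NV Mk.
case: (ex_minnP exH) => n /asboolP[H sH nH] nmin.
(* By minimality of the length, the remaining functionals no longer describe M within ZM. *)
have irr h : h \in H -> exists x, [/\ ZZ v x, dot x h < 0
    & forall h', h' \in H -> h' != h -> 0 <= dot x h'].
  move=> hH; apply: contrapT => nex.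
  have : (n <= size [seq k <- H | predC1 h k])%N.
    apply: nmin; apply/asboolP; exists ([seq k <- H | predC1 h k]) => // x Zx.
    split=> [/(sH x Zx).1 hx h'|hx]; first by rewrite mem_filter => /andP[_]; apply: hx.
    apply/(sH x Zx) => h' h'H; have [->|h'h] := eqVneq h' h; last first.
      by apply: hx; rewrite mem_filter /= h'h.
    rewrite leNgt; apply/negP => xh; apply: nex; exists x; split=> // k kH kh.
    by apply: hx; rewrite mem_filter /= kh.
  have c0 : (0 < count (pred1 h) H)%N by rewrite -has_count has_pred1.
  rewrite size_filter -nH leqNgt -(count_predC (pred1 h) H).
  by rewrite -[X in (X < _)%N]add0n ltn_add2r c0.
have vH i h : h \in H -> 0 <= dot (v i) h.
  by move=> hH; apply: (sH (v i) _).1 => //; [exact/MM_ZZ/MMv|exact: MMv].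
pose Pd h d := [/\ 0 < d, exists2 x, ZZ v x & dot x h = d
    & forall x, ZZ v x -> exists z : int, dot x h = z%:~R * d].
have [d Hd] : exists d : 'cV[rat]_q -> rat, forall h, h \in H -> Pd h (d h).
  have /choice[d Hd] : forall h, exists d, h \in H -> Pd h d.
    move=> h; have [hH|] := boolP (h \in H); last by exists 0.
    have [x [Zx xh _]] := irr h hH.
    have [|d Hd] := @ZZ_dot_lattice h; last by exists d.
    by exists x; rewrite // lt_eqF.
  by exists d.
pose nm h := (d h)^-1 *: h.
have nm_ge0 x h : h \in H -> (0 <= dot x (nm h)) = (0 <= dot x h).
  by move=> /Hd[d0 _ _]; rewrite dotZr pmulr_rge0 // invr_gt0.
have nm_int x h : h \in H -> ZZ v x -> exists z : int, dot x (nm h) = z%:~R.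
  move=> /Hd[d0 _ Hz] Zx; have [z xz] := Hz x Zx; exists z.
  by rewrite dotZr xz mulrC mulfK // gt_eqF.
exists [seq nm h | h <- H]; split.
- move=> x Zx; rewrite sH //; split=> [hx _ /mapP[h hH ->]|hx h hH].
    by rewrite nm_ge0 // hx.
  by rewrite -nm_ge0 // hx // map_f.
- by move=> _ x /mapP[h hH ->]; apply: nm_int.
move=> _ /mapP[h hH ->].
have [x [Zx xh xh']] := irr h hH.
pose w := \sum_i v i.
have Zw : ZZ v w by apply/ZZ_int; exists (fun=> 1); apply: eq_bigr => i _.
have wpos k : k \in H -> 0 < dot w (nm k).
  move=> kH; have [d0 _ _] := Hd k kH; rewrite dotZr pmulr_rgt0 ?invr_gt0 //.
  have w0 : 0 <= dot w k by rewrite dot_suml; apply: sumr_ge0 => i _; apply: vH.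
  rewrite lt_neqAle w0 andbT eq_sym; apply/eqP => wk.
  have vk i : dot (v i) k = 0.
    apply/eqP; rewrite eq_le vH // andbT -wk dot_suml (bigD1 i) //= lerDl.
    by apply: sumr_ge0 => j _; apply: vH.
  have [y [/ZZ_int[a ->] + _]] := irr k kH.
  by rewrite dot_suml big1 ?ltxx // => i _; rewrite dotMz vk mulr0.
have [za xza] := nm_int x h hH Zx; have [zb wzb] := nm_int w h hH Zw.
have za0 : za < 0.
  have [d0 _ _] := Hd h hH.
  by rewrite -(ltrz0 rat) -xza dotZr pmulr_rlt0 // invr_gt0.
have zb0 : 0 < zb by rewrite -(ltr0z rat) -wzb wpos.
(* A lattice point inside the facet of [h]: [x] violates only [h], [w] is interior, and their values
   under [h] cancel. *)
pose p := x *~ zb - w *~ za.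
have Zp : ZZ v p by apply: ZZB; exact: ZZz.
have ph : dot p (nm h) = 0 by rewrite dotBl !dotMz xza wzb mulrC subrr.
have ph' k : k \in H -> nm k != nm h -> 1 <= dot p (nm k).
  move=> kH kh; have kh' : k != h by apply: contra kh => /eqP ->.
  have [z pz] := nm_int p k kH Zp; rewrite pz ler1z -gtz0_ge1 -(ltr0z rat) -pz.
  rewrite dotBl !dotMz subr_gt0; apply: (@lt_le_trans _ _ 0).
    by rewrite pmulr_llt0 ?wpos // ltrz0.
  by rewrite mulr_ge0 ?ler0z ?(ltW zb0) // nm_ge0 // xh'.
have [d0 [x0 Zx0 x0h] _] := Hd h hH.
have [t [t0 tmax _]] := seq_max0 [seq dot x0 (nm k) | k <- H].
pose N := Num.bound t; have tN : t <= N%:R by apply/ltW/archi_boundP.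
(* The normalised [h] is 0 on [p] and 1 on [x0]; a large [N] makes all other functionals
   nonnegative. *)
exists (p *+ N - x0); split; first by apply: ZZB => //; exact: ZZn.
  by rewrite dotBl dotMn ph mulr0 sub0r dotZr x0h mulVf // gt_eqF.
move=> _ /mapP[k kH ->] kh; rewrite dotBl dotMn subr_ge0.
apply: le_trans (_ : t <= _); first by apply/tmax/map_f.
by apply: le_trans tN _; rewrite ler_peMr // ph'.
Qed.

Section Facets.
Variable H : seq 'cV[rat]_q.
Hypothesis facetsH : facets H.

Let sH x : ZZ v x -> (MM v x <-> forall h, h \in H -> 0 <= dot x h).
Proof. by have [+ _ _] := facetsH; apply. Qed.

(** If h(y) > k for a facet functional h, the point with h = -1 violates the condition of [W].
    Conversely, h(y) <= k and (k + 1) h(d) + h(y) >= 0 force the integer h(d) above -1. *)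
Lemma W_normal k y :
  W v k.+1 y <-> ZZ v y /\ forall h, h \in H -> 0 <= dot y h <= k%:R.
Proof.
have [_ intH facetH] := facetsH.
split=> [[My Wy]|[Zy yk]].
  have Zy := MM_ZZ My; split=> // h hH; have [z yz] := intH h y hH Zy.
  rewrite (sH Zy).1 //= leNgt; apply/negP => ky.
  have [d [Zd dh dh']] := facetH h hH.
  have : MM v d.
    apply: Wy => //; apply/sH; first by apply: ZZD => //; exact: ZZn.
    move=> h' h'H; rewrite dotDl dotMn; have [->|h'h] := eqVneq h' h; last first.
      by rewrite addr_ge0 ?mulr_ge0 ?dh' // (sH Zy).1.
    rewrite dh mulrN1 addrC subr_ge0; move: ky; rewrite yz.
    rewrite -[k%:R]/(k%:~R) -[k.+1%:R]/(k.+1%:~R) ltr_int ler_int; lia.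
  by move/(sH Zd) => /(_ h hH); rewrite dh oppr_ge0 leNgt ltr01.
split; first by apply/sH => // h /yk /andP[].
move=> d Zd /sH Md; apply/sH => // h hH.
have [z dz] := intH h d hH Zd.
have /(_ h hH) := Md (ZZD (ZZn _ Zd) Zy).
have /andP[_ yk'] := yk h hH.
rewrite dotDl dotMn dz ler0z => h0.
have : 0 <= k.+1%:R * z%:~R + k%:R :> rat by apply: le_trans h0 _; rewrite lerD2l.
rewrite -[k%:R]/(k%:~R) -[k.+1%:R]/(k.+1%:~R) -intrM -intrD ler0z.
case: z {dz h0} => // n; rewrite NegzE; nia.
Qed.

(** By [W_normal] the pairs of height k are the points of W_(k+1); this index shift makes the pairs
    closed under addition. *)
Definition dilates (p : 'rV[rat]_q * nat) :=
  ZZ v p.1 /\ forall h, h \in H -> 0 <= dot p.1 h <= p.2%:R.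

Lemma dilates0 : dilates 0.
Proof. by split=> [|h _]; [exact: ZZ0|rewrite dot0l lexx]. Qed.

Lemma dilatesD p p' : dilates p -> dilates p' -> dilates (p + p').
Proof.
move=> [Zp hp] [Zp' hp']; split=> [|h hH]; first exact: ZZD.
have /andP[a b] := hp h hH; have /andP[a' b'] := hp' h hH.
by rewrite /= dotDl addr_ge0 //= natrD lerD.
Qed.

Lemma dilates_ht0 p : dilates p -> p.2 = 0%N -> p = 0.
Proof.
case: p => y k [/= Zy hy] k0; congr (_, _) => //.
have y0 h : h \in H -> dot y h = 0.
  by move=> /hy; rewrite k0 -eq_le => /eqP.
by apply: pointed; apply/sH => //; [move=> h /y0 ->|exact: ZZN|move=> h /y0; rewrite dotNl => ->; rewrite oppr0].
Qed.

(* Gordan's lemma for the cone over the polytope 0 <= h <= 1, h in H. *)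
Lemma gordan : exists (J : finType) (t : J -> 'rV[rat]_q * nat),
  (forall j, dilates (t j)) /\ forall p, dilates p -> exists c, p = ev t c.
Proof.
have [_ intH _] := facetsH.
pose nr (a : rat) := `|numq a|%N.
have nrK p h : dilates p -> h \in H -> (nr (dot p.1 h))%:R = dot p.1 h.
  move=> [Zp hp] hH; have [z pz] := intH h p.1 hH Zp; have /andP[] := hp h hH.
  rewrite pz /nr numq_int ler0z => z0 _.
  by rewrite -[in RHS](gez0_abs z0).
have nr_le p h : dilates p -> h \in H -> (nr (dot p.1 h) <= p.2)%N.
  move=> Tp hH; rewrite -(ler_nat rat) nrK //.
  by case: Tp => _ /(_ h hH)/andP[].
(* Besides the height, both h(p) and its distance to the height are recorded, so that subtracting a
   smaller representative stays within [dilates]. *)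
pose f (o : option ('I_(size H) * bool)) (p : 'rV[rat]_q * nat) : nat :=
  if o is Some (i, b) then
    let a := nr (dot p.1 (H`_i)) in if b then a else (p.2 - a)%N
  else p.2.
have [J [t [Tt Jt]]] := dickson_representatives f (fun p => dilates p /\ p != 0) 0.
have {}Tt j : dilates (t j) by have [[]//|->] := Tt j; exact: dilates0.
exists J, t; split=> // p; have [n] := ubnP p.2; elim: n p => // n IH p pn Tp.
have [->|p0] := eqVneq p 0; first by exists [ffun=> 0%N]; rewrite ev0.
have [j [[_ j0] jp]] := Jt p (conj Tp p0).
have Tj := Tt j.
have le2 : ((t j).2 <= p.2)%N := jp None.
have ht0 : (0 < (t j).2)%N.
  by rewrite lt0n; apply: contra j0 => /eqP /(dilates_ht0 Tj) ->.
pose p' := (p.1 - (t j).1, (p.2 - (t j).2)%N).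
have Tp' : dilates p'.
  split=> [|h hH]; first by apply: ZZB; [case: Tp|case: Tj].
  have hs : (index h H < size H)%N by rewrite index_mem.
  have := jp (Some (Ordinal hs, true)); have := jp (Some (Ordinal hs, false)).
  rewrite /= !nth_index // => l1 l2.
  have n1 := nr_le p h Tp hH; have n2 := nr_le _ h Tj hH.
  rewrite dotBl -(nrK _ _ Tp hH) -(nrK _ _ Tj hH) -natrB // ler0n ler_nat /=.
  by move: l1 l2 n1 n2; clear; lia.
have [c p'c] : exists c, p' = ev t c by apply: IH => //=; lia.
exists [ffun i => (c i + [ffun i => (i == j) : nat] i)%N].
rewrite evD ev1 -p'c; apply: injective_projections.
  by rewrite -[RHS]/(p.1 - (t j).1 + (t j).1) subrK.
by rewrite -[RHS]/(p.2 - (t j).2 + (t j).2)%N subnK.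
Qed.

Lemma dilates_rational_growth :
  rational_growth (fun n => (ncard [set p | dilates p /\ (p.2 < n)%N])%:R : R).
Proof.
have [J [t [Tt Jt]]] := gordan.
have [L [K [Ldown Linj Lonto K0 Ltrunc]]] := standard_representations t.
have Tev c : dilates (ev t c).
  rewrite /ev; elim/big_ind: _ => [|p p'|i _]; [exact: dilates0|exact: dilatesD|].
  elim: (c i) => [|k IH]; first exact: dilates0.
  by rewrite mulrS; apply: dilatesD.
have ht_ev c : (ev t c).2 = (\sum_i c i * (t i).2)%N.
  rewrite /ev (big_morph snd (id1 := 0%N) (op1 := addn)) //; apply: eq_bigr => i _.
  elim: (c i) => // k IH; rewrite mulrS mulSn -IH.
  by [].
pose C n := [set c | L c /\ ((ev t c).2 < n)%N].
have CE n : [set p | dilates p /\ (p.2 < n)%N] = ev t @` C n.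
  apply/seteqP; split=> [p [Tp pn]|_ [c [_ cn] <-] //].
  have [c pc] := Jt p Tp; have [c' Lc' c'c] := Lonto c.
  by exists c'; rewrite /C /= c'c -?pc.
(* A generator of height 0 is zero and has exponent 0 in [L], so free coordinates have positive
   weight. *)
have hK u i : L u -> i \in trunc_top K u -> (0 < (t i).2)%N.
  move=> Lu; rewrite inE lt0n => /eqP ui; apply/eqP => ti.
  have := standard_zero Ldown Linj Lu (dilates_ht0 (Tt i) ti).
  by rewrite ui => k0; move: K0; rewrite k0.
have finC n : finite_set (C n).
  apply: sub_finite_set (box_card (fun=> 0%N) (fun=> n)).1 => c [Lc cn] i.
  rewrite /= add0n; apply: leq_ltn_trans cn.
  have [ti|ti] := posnP (t i).2.
    by rewrite (standard_zero Ldown Linj Lc (dilates_ht0 (Tt i) ti)).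
  by rewrite ht_ev (bigD1 i) //= (leq_trans _ (leq_addr _ _)) // leq_pmulr.
under eq_fun => n.
  rewrite CE ncard_image //; last by move=> c c' [Lc _] [Lc' _]; apply: Linj.
  rewrite (ncard_trunc_partition K) // natr_sum.
  over.
apply: rational_growth_sum => u0; set u : {ffun J -> nat} := [ffun i => u0 i : nat].
have [[Lu tu]|nu] := pselect (L u /\ trunc K u = u); last first.
  left=> n; suff -> : [set c | C n c /\ trunc K c = u] = set0.
    by rewrite /ncard fset_set0 cardfs0.
  apply/seteqP; split=> // c [[Lc _] tc]; apply: nu; rewrite -tc; split.
    exact: (Ltrunc c).1.
  by apply/ffunP => i; rewrite !ffunE -minnA minnn.
(* The piece is [u] plus a simplex weighted by heights; for [n] at most the height of [u] the
   truncated size is 0 and both sides are empty. *)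
have pieceE n : ncard [set c | C n c /\ trunc K c = u] =
    ncard (simplex (fun i => (t i).2) (enum (trunc_top K u)) (n - (ev t u).2)).
  pose f (c : {ffun J -> nat}) : {ffun J -> nat} := [ffun i => (c i + u i)%N].
  have fin : finite_set (simplex (fun i => (t i).2) (enum (trunc_top K u)) (n - (ev t u).2)).
    by apply: finite_simplex => i; rewrite mem_enum; apply: hK.
  rewrite -(ncard_image (f := f) fin); last first.
    by move=> c d _ _ /ffunP cd; apply/ffunP => i; have := cd i; rewrite !ffunE => /addIn.
  congr ncard; apply/seteqP; split=> [c [[Lc cn] tc]|_ [c [cu cn] <-]].
    have uc i : (u i <= c i)%N by rewrite -tc ffunE geq_minl.
    exists [ffun i => (c i - u i)%N]; last first.
      by apply/ffunP => i; rewrite !ffunE subnK //; have := uc i; rewrite ffunE.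
    split=> [i|]; first by rewrite mem_enum ffunE => /(trunc_off tc) ->; rewrite subnn.
    have hc : (ev t c).2 = ((ev t u).2 + (ev t [ffun i => (c i - u i)%N]).2)%N.
      by rewrite (ev_split t uc).
    by rewrite ltn_subRL -ht_ev -hc.
  have tfu : trunc K (f c) = u.
    apply/ffunP => i; rewrite [LHS]ffunE [f c i]ffunE; have [iu|iu] := boolP (i \in trunc_top K u).
      by move: (iu); rewrite inE => /eqP ->; apply/minn_idPr/leq_addl.
    by rewrite cu ?mem_enum // add0n -[in RHS]tu [RHS]ffunE.
  split=> //; split; first by apply/Ltrunc; rewrite tfu.
  have -> : (ev t (f c)).2 = ((ev t c).2 + (ev t u).2)%N by rewrite evD.
  by rewrite addnC -ltn_subRL ht_ev.
right; exists (size (enum (trunc_top K u))).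
have [|c c0 Hc] := @simplex_growth R _ (fun i => (t i).2) _ (enum_uniq (trunc_top K u)).
  by move=> i; rewrite mem_enum; apply: hK.
exists c; split=> //; under eq_fun do rewrite pieceE.
exact: (growth_shift (a := fun n => (ncard (simplex _ _ n))%:R)).
Unshelve. all: end_near. Qed.

End Facets.

(** The partial sums [F] count [dilates] by height, hence have rational growth; summation shows that
    they are asymptotic to l / (s + 1) times n^(s+1). *)
Lemma normal_rational_limit s (l : R) : 0 < l ->
  cvg_along (AA v) (fun m => (ncard [set y | W v m y])%:R / m%:R ^+ s) l ->
  exists r : rat, l = ratr r.
Proof.
move=> l0 cl; have [H facetsH] := exists_facets.
pose F n := (\sum_(k < n) ncard [set y | W v k.+1 y])%N.
pose A n := [set p | dilates H p /\ (p.2 < n)%N].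
have finA n : finite_set (A n).
  elim: n => [|n IH]; first by apply: sub_finite_set (finite_set0 _) => p [].
  have fW : finite_set ((fun y => (y, n)) @` [set y | W v n.+1 y]).
    exact/finite_image/finite_W.
  apply: (@sub_finite_set _ _ (A n `|` (fun y => (y, n)) @` [set y | W v n.+1 y])).
    move=> [y k] [Tp]; rewrite /= ltnS leq_eqVlt => /orP[/eqP kn|kn]; last by left.
    by right; exists y; [apply/(W_normal facetsH); rewrite -kn|rewrite kn].
  by rewrite finite_setU.
have aW : ((ncard [set y | W v n y])%:R / n%:R ^+ s : R) @[n --> \oo] --> l.
  apply/cvgrPdist_le => e /cl[N HN]; exists (maxn N 1) => // n /= Nn.
  rewrite distrC; apply: HN; first exact: leq_trans (leq_maxl _ _) Nn.
  by apply: normal_AA; apply: leq_trans Nn; rewrite leq_maxr.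
have aF : ((F n)%:R / n%:R ^+ s.+1 : R) @[n --> \oo] --> l / (1 * s.+1)%:R.
  apply: (growth_integral (a := fun n => (ncard [set y | W v n y])%:R)) => // n.
  by rewrite -natrD addn1 /F big_ord_recr.
have rF : rational_growth (fun n => (F n)%:R : R).
  have FE n : F n = ncard (A n).
    elim: n => [|n IH].
      rewrite /F big_ord0; have -> : A 0%N = set0 by apply/seteqP; split=> // p [].
      by rewrite /ncard fset_set0 cardfs0.
    rewrite /F big_ord_recr /= -/(F n) IH (ncard_partition (fun p => p.2 == n) (finA n.+1)).
    rewrite big_bool [RHS]addnC; congr (_ + _)%N.
      congr ncard; apply/seteqP; split=> p /=.
        by move=> [Tp pn]; split; [split=> //; apply: leqW|rewrite ltn_eqF].
      by move=> [[Tp pn] /negbT pn']; split=> //; rewrite ltn_neqAle pn' -ltnS.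
    rewrite -(ncard_image (f := fun y => (y, n)) (finite_W pointed _)) //; last by move=> y z _ _ [].
    congr ncard; apply/seteqP; split=> [_ [y /(W_normal facetsH)[Zy hy] <-]|[y k] [[[Zy hy] kn] /eqP/= kE]].
      by rewrite /= eqxx; do 2!split=> //.
    by rewrite /= in hy *; exists y; rewrite -kE //; apply/(W_normal facetsH).
  under eq_fun do rewrite FE.
  exact: dilates_rational_growth.
have lpos : 0 < l / (1 * s.+1)%:R :> R by rewrite divr_gt0 // ltr0n mul1n.
have [r lr] := rational_growth_lim rF lpos aF.
by exists (r * (1 * s.+1)%:R); rewrite rmorphM rmorph_nat /= -lr divfK //.
Qed.

End Normal.

(** * Passage between the given definitions and the rational model *)

Section Transfer.
Variable q : nat.
Implicit Types (x y z : 'rV[int]_q) (M N : set 'rV[int]_q).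

Lemma toQ0 : @toQ q 0 = 0. Proof. by rewrite /toQ map_mx0. Qed.
Lemma toQD x y : toQ (x + y) = toQ x + toQ y. Proof. by rewrite /toQ map_mxD. Qed.
Lemma toQN x : toQ (- x) = - toQ x. Proof. by rewrite /toQ map_mxN. Qed.
Lemma toQB x y : toQ (x - y) = toQ x - toQ y. Proof. by rewrite toQD toQN. Qed.
Lemma toQMn x k : toQ (x *+ k) = toQ x *+ k.
Proof. by elim: k => [|k IH]; rewrite ?mulr0n ?toQ0 // !mulrS toQD IH. Qed.

Lemma toQ_inj x y : toQ x = toQ y -> x = y.
Proof.
move=> /rowP xy; apply/rowP => j; have := xy j; rewrite !mxE => /eqP.
by rewrite eqr_int => /eqP.
Qed.

Lemma toR_inj (R : realType) x y : toR R x = toR R y -> x = y.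
Proof.
move=> /rowP xy; apply/rowP => j; have := xy j; rewrite !mxE => /eqP.
by rewrite eqr_int => /eqP.
Qed.

Lemma toR_toQ (R : realType) x : toR R x = map_mx ratr (toQ x).
Proof. by apply/rowP => j; rewrite !mxE ratr_int. Qed.

Lemma gen_group_sub N x : N x -> gen_group N x.
Proof. by move=> Nx G [_ NG]; apply: NG. Qed.

Lemma gen_groupP N x : N 0 -> (forall y z, N y -> N z -> N (y + z)) ->
  gen_group N x <-> exists y z, [/\ N y, N z & x = y - z].
Proof.
move=> N0 ND; split=> [Gx|[y [z [Ny Nz ->]]]].
  apply: (Gx [set x | exists y z, [/\ N y, N z & x = y - z]]).
  split=> [|y Ny]; last by exists y, 0; rewrite subr0.
  split=> [|_ _ [a [b [Na Nb ->]]] [c [d [Nc Nd ->]]]]; first by exists 0, 0; rewrite subr0.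
  exists (a + d), (b + c); split; [exact: ND|exact: ND|].
  by rewrite opprB opprD addrACA.
by move=> G [[_ GB] NG]; apply: GB; apply: NG.
Qed.

Section Generators.
Variables (R : realType) (n : nat) (g : 'I_n -> 'rV[int]_q) (M : set 'rV[int]_q).
Hypothesis ME : M = [set x | exists c : 'I_n -> nat, x = \sum_i g i *+ c i].
Hypothesis M_ge0 : forall x, M x -> forall j, 0 <= x 0 j.

Let v i := toQ (g i).

Lemma toQ_ev (c : {ffun 'I_n -> nat}) : toQ (\sum_i g i *+ c i) = ev v c.
Proof.
rewrite (big_morph (@toQ q) toQD toQ0); apply: eq_bigr => i _.
by rewrite toQMn.
Qed.

Lemma MMP (a : 'rV[rat]_q) : MM v a <-> exists2 x, M x & a = toQ x.
Proof.
rewrite ME; split=> [[c ->]|[_ [c ->] ->]].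
  by exists (\sum_i g i *+ c i); [exists c|rewrite toQ_ev].
exists [ffun i => c i]; rewrite -toQ_ev; congr toQ.
by apply: eq_bigr => i _; rewrite ffunE.
Qed.

Lemma M_MM x : M x <-> MM v (toQ x).
Proof. by rewrite MMP; split=> [Mx|[y My /toQ_inj ->] //]; exists x. Qed.

Lemma M0 : M 0.
Proof. by apply/M_MM; rewrite toQ0; exact: MM0. Qed.

Lemma MD x y : M x -> M y -> M (x + y).
Proof. by rewrite !M_MM toQD; exact: MMD. Qed.

Lemma ZZP (a : 'rV[rat]_q) : ZZ v a <-> exists2 x, gen_group M x & a = toQ x.
Proof.
split=> [[_ [_ [/MMP[x Mx ->] /MMP[y My ->] ->]]]|[x + ->]].
  exists (x - y); last by rewrite toQB.
  by apply/(gen_groupP _ M0 MD); exists x, y.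
move=> /(gen_groupP _ M0 MD)[y [z [My Mz ->]]]; exists (toQ y), (toQ z).
by rewrite toQB; split=> //; apply/M_MM.
Qed.

Lemma M_pointed a : MM v a -> MM v (- a) -> a = 0.
Proof.
move=> /MMP[x Mx ->]; rewrite -toQN => /M_MM Mx'; suff -> : x = 0 by rewrite toQ0.
apply/rowP => j; have := M_ge0 Mx j; have := M_ge0 Mx' j; rewrite !mxE oppr_ge0 => a1 a2.
by apply/eqP; rewrite eq_le a1.
Qed.

Lemma seminormal_SN : seminormal M ->
  forall a, ZZ v a -> MM v (a *+ 2) -> MM v (a *+ 3) -> MM v a.
Proof.
move=> sn _ /ZZP[x Gx ->]; rewrite -!toQMn -!M_MM.
exact: sn.
Qed.

Lemma frac_MM m a : (0 < m)%N -> Defs.frac M m a <-> MM v (a *+ m).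
Proof.
move=> m0; have m0Q : (m%:R : rat) != 0 by rewrite pnatr_eq0 -lt0n.
rewrite MMP; split=> [[x Mx <-]|[x Mx ax]]; exists x => //.
  by rewrite -scaler_nat scalerA mulfV // scale1r.
by rewrite -ax -scaler_nat scalerA mulVf // scale1r.
Qed.

Lemma Aset_AA m : Aset M m <-> AA v m.
Proof.
split=> [[m0 /seteqP[sub _]]|[m0 Am]]; split=> //.
  move=> a /ZZP Za Ma; have [|x Mx <-] := sub a; last exact/M_MM.
  by split; [apply/frac_MM|case: Za => x Gx ->; exists x].
apply/seteqP; split=> [a [/(frac_MM _ m0) fa [x Gx xa]]|_ [x Mx <-]].
  have /MMP[y My ->] : MM v a by apply: Am => //; apply/ZZP; exists x.
  by exists y.
split; last by exists x => //; exact: gen_group_sub.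
by apply/frac_MM => //; apply/MMn/M_MM.
Qed.

(** A difference d = x - y violating the condition of [W] gives a point d + a outside a + M that
    enters it when y is added, against purity. Conversely, a point entering a + M differs from a by
    an element of ZM, to which that condition applies. *)
Lemma Vset_W m a : (0 < m)%N -> Vset M m a <-> W v m (a *+ m).
Proof.
move=> m0; split=> [[/(frac_MM _ m0) fa [_ _ _ pur]]|[Ma Wa]].
  split=> // d /ZZP[_ /(gen_groupP _ M0 MD)[x [y [Mx My ->]]] ->] Md.
  set e := toQ (x - y) in Md *.
  have fe : Defs.frac M m (e + a) by apply/frac_MM => //; rewrite mulrnDl.
  apply: contrapT => nMe.
  have : (Defs.frac M m `\` translate M a) (e + a).
    split=> // -[z Mz /eqP]; rewrite addrC => /eqP/addIr ze.
    by apply: nMe; rewrite -ze; apply/M_MM.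
  move=> /pur /(_ My) [_]; apply; exists x => //.
  by rewrite /e toQB addrAC subrK addrC.
split; first exact/frac_MM.
split.
- move=> _ w [u Mu <-] Mw; exists (u + w); first exact: MD.
  by rewrite toQD addrA.
- move=> u w /(frac_MM _ m0) fu Mw; apply/frac_MM => //; rewrite mulrnDl.
  by apply: MMD => //; apply/MMn/M_MM.
- move=> _ [u Mu <-]; apply/frac_MM => //; rewrite mulrnDl.
  by apply: MMD => //; apply/MMn/M_MM.
move=> u w [/(frac_MM _ m0) fu nu] Mw; split.
  apply/frac_MM => //; rewrite mulrnDl.
  by apply: MMD => //; apply/MMn/M_MM.
move=> [y My] /eqP; rewrite -subr_eq => /eqP uE; apply: nu.
have ua : u = a + (toQ y - toQ w) by rewrite -uE addrA.
have /MMP[z Mz zE] : MM v (toQ y - toQ w).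
  apply: Wa; first by apply/ZZB; apply/MM_ZZ/M_MM.
  by rewrite -mulrnDl addrC -ua.
by exists z => //; rewrite ua zE.
Qed.

Lemma Vset_ncard m : (0 < m)%N -> ncard (Vset M m) = ncard [set y | W v m y].
Proof.
move=> m0; have m0Q : (m%:R : rat) != 0 by rewrite pnatr_eq0 -lt0n.
have hM : affine_monoid M by split=> //; exists n, g.
rewrite -(ncard_image (f := fun a => a *+ m) (finite_Vset hM m0)) => [|a b _ _].
  congr ncard; apply/seteqP; split=> [_ [a /(Vset_W _ m0) Wa <-] //|y Wy].
  have yE : (m%:R^-1 *: y) *+ m = y by rewrite -scaler_nat scalerA mulfV // scale1r.
  by exists (m%:R^-1 *: y) => //; apply/Vset_W; rewrite ?yE.
by rewrite -!scaler_nat => /(scalerI m0Q).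
Qed.

Lemma pure_prime_SS : M `\` pure_prime M = [set x | SS v (toQ x)].
Proof.
apply/seteqP; split=> [x [Mx nP]|x [m m1 Wx]].
  have [m [m1 [a Va xa]]] : exists m, (1 < m)%N /\ exists2 a, Vset M m a & toQ x = m%:R *: a.
    by apply: contrapT => nex; apply: nP; split.
  exists m => //; rewrite xa scaler_nat; apply/Vset_W => //.
  exact: ltnW.
split=> [|[_]]; first by apply/M_MM; case: Wx.
apply; exists m; split=> //; exists (m%:R^-1 *: toQ x).
  apply/Vset_W; first exact: ltnW.
  by rewrite -scaler_nat scalerA mulfV ?scale1r // pnatr_eq0 -lt0n ltnW.
by rewrite scalerA mulfV ?scale1r // pnatr_eq0 -lt0n ltnW.
Qed.

Lemma gen_cone_M x : M x -> gen_cone R M (toR R x).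
Proof.
by move=> Mx; exists 1%N, (fun=> 1), (fun=> x); split=> //; rewrite big_ord1 scale1r.
Qed.

(** Ensures that [pure_prime_face] is a genuine choice and not the default [set0]; the supporting
    functional cuts out the face. *)
Lemma exists_pure_prime_face : SS v 0 -> exists F : set 'rV[R]_q, is_pure_prime_face M F.
Proof.
move=> S0; have [l Hl] := supporting_functional S0.
have dot_l x : (toR R x *m map_mx ratr l) 0 0 = ratr (dot (toQ x) l).
  by rewrite toR_toQ -map_mxM mxE.
have l_ge0 x : M x -> 0 <= dot (toQ x) l.
  move=> /M_MM[c ->]; rewrite dot_suml; apply: sumr_ge0 => i _.
  by rewrite dotMn mulr_ge0 //; case: (Hl i).
exists (gen_cone R M `&` [set x | (x *m map_mx ratr l) 0 0 = 0]); split.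
  exists (map_mx ratr l), 0; split=> // _ [k [c [w [c0 Mw ->]]]].
  rewrite mulmx_suml summxE; apply: sumr_ge0 => i _.
  by rewrite -scalemxAl mxE dot_l mulr_ge0 // ler0q l_ge0.
rewrite pure_prime_SS; apply/seteqP; split=> [x Sx|x [Mx [_ /= lx]]].
  have Mx : M x by apply/M_MM/SS_MM.
  split=> //; split; first exact: gen_cone_M.
  have [c xc] := SS_MM Sx; have Sc : SS v (ev v c) by rewrite -xc.
  rewrite /= dot_l xc dot_suml big1 ?rmorph0 // => i _; rewrite dotMn.
  have [->|ci] := posnP (c i); first by rewrite mul0r.
  by case: (Hl i) => _; rewrite ((SS_ev c S0).1 Sc i ci) => /eqP ->; rewrite mulr0.
have /M_MM[c xc] := Mx; rewrite xc; apply/(SS_ev c S0) => i ci.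
case: (Hl i) => li0 <-; move: lx; rewrite dot_l => /eqP.
rewrite fmorph_eq0 xc dot_suml psumr_eq0 => [/allP/(_ i)|j _]; last first.
  by rewrite dotMn mulr_ge0 //; case: (Hl j).
by rewrite mem_index_enum dotMn mulf_eq0 pnatr_eq0 eqn0Ngt ci /=; apply.
Qed.

(** Any admissible face meets M in M minus its pure prime, so the rank is independent of the choice;
    0 lies in the face, which excludes the value [None]. *)
Lemma mpdimE : SS v 0 -> mpdim R M = Some (\dim <<[seq v i | i <- enum (SI v)]>>).
Proof.
move=> S0; have : is_pure_prime_face M (pure_prime_face R M).
  exact: (xgetPex set0 (exists_pure_prime_face S0)).
rewrite /mpdim; move: (pure_prime_face R M) => F [_]; rewrite pure_prime_SS => SF.
case: asboolP => [F0|_].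
  exfalso; have : [set x | SS v (toQ x)] 0 by rewrite /= toQ0.
  by rewrite SF F0 => -[].
rewrite -SF; congr Some; rewrite /rank.
have SD x y : SS v (toQ x) -> SS v (toQ y) -> SS v (toQ (x + y)).
  by rewrite toQD; exact: SSD.
have [UP Umin] := QspanP (@toQ q @` gen_group [set x | SS v (toQ x)]).
suff -> : Qspan (@toQ q @` gen_group [set x | SS v (toQ x)]) =
  <<[seq v i | i <- enum (SI v)]>>%VS by [].
apply/eqP; rewrite eqEsubv; apply/andP; split.
  apply: Umin => _ [x + <-].
  rewrite gen_groupP /= ?toQ0 // => -[y [z [Sy Sz ->]]]; rewrite toQB.
  have span a : SS v a -> a \in <<[seq v i | i <- enum (SI v)]>>%VS.
    by move=> Sa; case: (SS_MM Sa) => c ac; rewrite ac; apply/memS/SS_ev; rewrite -?ac.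
  by rewrite rpredB // span.
apply/span_subvP => _ /mapP[i + ->]; rewrite mem_enum => /SIP Si.
by apply: UP; exists (g i) => //; exact: gen_group_sub.
Qed.

(** If k x is in M, then x is 1/k times k x and so lies in the real cone. *)
Lemma normal_NV : normal_monoid R M ->
  forall a k, ZZ v a -> (0 < k)%N -> MM v (a *+ k) -> MM v a.
Proof.
move=> /seteqP[nM _] _ k /ZZP[x Gx ->] k0; rewrite -toQMn -!M_MM => Mx.
have k0' : k%:R != 0 :> R by rewrite pnatr_eq0 -lt0n.
have [|y My /toR_inj <- //] := nM (toR R x).
split; last by exists x.
exists 1%N, (fun=> k%:R^-1), (fun=> x *+ k); split=> //.
rewrite big_ord1; apply/rowP => j; rewrite !mxE mulmxnE rmorphMn /=.
by rewrite -[X in _ = _ * X]mulr_natl mulKf.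
Qed.

End Generators.
End Transfer.

(** * Convergence along increasing sequences in A(M) *)

Theorem theorem3 (R : realType) (q : nat) (hq : (0 < q)%N)
    (M : set 'rV[int]_q) (hM : affine_monoid M) (hsn : seminormal M) :
  exists s : nat, mpdim R M = Some s /\
  exists mpr : R,
    [/\ 0 < mpr,
        forall m : nat -> nat,
          (forall t u, (t < u)%N -> (m t < m u)%N) ->
          (forall t, Aset M (m t)) ->
          (fun t => (#|` fset_set (Vset M (m t))|%:R / (m t)%:R ^+ s : R))
            @ \oo --> mpr
      & normal_monoid R M -> exists r : rat, mpr = ratr r].
Proof.
have [[n [g ME]] M_ge0] := hM.
pose v i := toQ (g i).
have pointed := M_pointed ME M_ge0.
have SN := seminormal_SN ME hsn.
eexists; split; first exact: (mpdimE R ME (SS0 SN)).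
have [l l0 cl] := W_limit R pointed SN.
exists l; split=> // [m m_incr mA|nM]; last first.
  exact: (normal_rational_limit pointed (normal_NV ME nM) l0 cl).
(* An increasing sequence dominates its index, so the limit along all of A, chosen before the
   sequence, is also its limit. *)
have mt t : (t <= m t)%N.
  by elim: t => // t IH; apply: leq_ltn_trans IH (m_incr _ _ (ltnSn t)).
apply/cvgrPdist_le => e /cl[N HN]; exists N => // t /= Nt.
have /(Aset_AA ME) Am := mA t.
rewrite distrC -/(ncard _) (Vset_ncard ME M_ge0); last by case: Am.
by apply: HN => //; apply: leq_trans Nt (mt t).
Qed.
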